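(* Fix $T>0$. Let $\mathbf e,\mathbf h$ be the exact solution of the Maxwell initial-boundary value problem described in the context, and suppose that both $\mathbf e$ and $\mathbf h$ belong to $$C([0,T];C^4(\overline\Omega))\cap C^1([0,T];C^2(\overline\Omega))\cap C^2([0,T];C^1(\overline\Omega))\cap C^3([0,T];C(\overline\Omega)).$$ Then there is a constant $C$, independent of $\Delta t,\Delta x,\Delta y,\Delta z$, such that for every $n\ge0$ with $(n+1)\Delta t\le T$ the errors $\mathcal E^n,\mathcal H^n$ of the ADI-FDTD scheme satisfy $$\|\mathcal E^{n+1}\|_E^2+\|\mathcal H^{n+1}\|_H^2+\frac{(\Delta t)^2}{4\mu\varepsilon}\Big(\|\delta_1^h\mathcal E^{n+1}\|_H^2+\|\delta_2^h\mathcal H^{n+1}\|_E^2\Big)\le C\{(\Delta t)^4+(\Delta x)^4+(\Delta y)^4+(\Delta z)^4\}$$ and $$\|\delta_t\mathcal E^{n+\frac12}\|_E^2+\|\delta_t\mathcal H^{n+\frac12}\|_H^2+\frac{(\Delta t)^2}{4\mu\varepsilon}\Big(\|\delta_1^h\delta_t\mathcal E^{n+\frac12}\|_H^2+\|\delta_2^h\delta_t\mathcal H^{n+\frac12}\|_E^2\Big)\le C\{(\Delta t)^4+(\Delta x)^4+(\Delta y)^4+(\Delta z)^4\}.$$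
   Context: **Continuous problem.** $\Omega=[0,1]^3$, $\varepsilon,\mu>0$ constants. $\mathbf e=(e_x,e_y,e_z)$, $\mathbf h=(h_x,h_y,h_z)$ solve the Maxwell equations $\varepsilon\,\partial_t\mathbf e=\nabla\times\mathbf h$, $\mu\,\partial_t\mathbf h=-\nabla\times\mathbf e$ in $(0,T]\times\Omega$, with the PEC boundary condition $\vec n\times\mathbf e=0$, $\vec n\cdot\mathbf h=0$ on $(0,T]\times\partial\Omega$ ($\vec n$ the outward normal, imposed face by face) and initial data $\mathbf e(0,\cdot)=\mathbf E_0$, $\mathbf h(0,\cdot)=\mathbf H_0$. The constant $C$ may depend on $T,\varepsilon,\mu$ and on the solution $\mathbf e,\mathbf h$. **Grid.** $I,J,K\ge2$ and $N\ge1$ are integers; $\Delta x=1/I$, $\Delta y=1/J$, $\Delta z=1/K$, $\Delta t=T/N$, $t^n=n\Delta t$; $\Delta v=\Delta x\Delta y\Delta z$; $\bar l:=l+\tfrac12$ for $l=i,j,k,n$. A grid function carries spatial indices $(\alpha,\beta,\gamma)$ (integers or half-integers), referring to the point $(x_\alpha,y_\beta,z_\gamma)=(\alpha\Delta x,\beta\Delta y,\gamma\Delta z)$, and a time index $m$ for time $m\Delta t$. ''$F|_{\alpha,\beta,\gamma}$'' means that all terms of $F$ are evaluated at spatial index $(\alpha,\beta,\gamma)$. The components live on staggered grids: $E_x$ at $(\bar i,j,k)$, $E_y$ at $(i,\bar j,k)$, $E_z$ at $(i,j,\bar k)$ (E-points); $H_x$ at $(i,\bar j,\bar k)$, $H_y$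 at $(\bar i,j,\bar k)$, $H_z$ at $(\bar i,\bar j,k)$ (H-points). An integer $x$-index runs over $0,\dots,I$ and a half-integer one over $\tfrac12,\dots,I-\tfrac12$, similarly for $y$ (with $J$) and $z$ (with $K$). **Difference operators.** $\delta_xU_{\alpha,\beta,\gamma}=(U_{\alpha+\frac12,\beta,\gamma}-U_{\alpha-\frac12,\beta,\gamma})/\Delta x$, and $\delta_y,\delta_z$ analogously; $\delta_tU^{m}=(U^{m+\frac12}-U^{m-\frac12})/\Delta t$, so $\delta_t\mathcal E^{n+\frac12}=(\mathcal E^{n+1}-\mathcal E^n)/\Delta t$. For vector grid functions $\delta_1^h\mathbf U=(\delta_yU_z,\delta_zU_x,\delta_xU_y)$, $\delta_2^h\mathbf U=(\delta_zU_y,\delta_xU_z,\delta_yU_x)$. Thus $\delta_1^h$ maps E-point functions to H-point functions and $\delta_2^h$ maps H-point functions to (interior) E-point functions. **ADI-FDTD scheme.** For every $0\le n\le N-1$: Stage 1: $\frac{E_x^{\bar n}-E_x^n}{\Delta t}=\frac1{2\varepsilon}(\delta_yH_z^{\bar n}-\delta_zH_y^n)|_{\bar i,j,k}$, $\frac{E_y^{\bar n}-E_y^n}{\Delta t}=\frac1{2\varepsilon}(\delta_zH_x^{\bar n}-\delta_xH_z^n)|_{i,\bar j,k}$, $\frac{E_z^{\bar n}-E_z^n}{\Delta t}=\frac1{2\varepsilon}(\delta_xH_y^{\bar n}-\delta_yH_x^n)|_{i,j,\bar k}$, $\frac{H_x^{\bar n}-H_x^n}{\Delta t}=\frac1{2\mu}(\delta_zE_y^{\bar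 n}-\delta_yE_z^n)|_{i,\bar j,\bar k}$, $\frac{H_y^{\bar n}-H_y^n}{\Delta t}=\frac1{2\mu}(\delta_xE_z^{\bar n}-\delta_zE_x^n)|_{\bar i,j,\bar k}$, $\frac{H_z^{\bar n}-H_z^n}{\Delta t}=\frac1{2\mu}(\delta_yE_x^{\bar n}-\delta_xE_y^n)|_{\bar i,\bar j,k}$. Stage 2: $\frac{E_x^{n+1}-E_x^{\bar n}}{\Delta t}=\frac1{2\varepsilon}(\delta_yH_z^{\bar n}-\delta_zH_y^{n+1})|_{\bar i,j,k}$, $\frac{E_y^{n+1}-E_y^{\bar n}}{\Delta t}=\frac1{2\varepsilon}(\delta_zH_x^{\bar n}-\delta_xH_z^{n+1})|_{i,\bar j,k}$, $\frac{E_z^{n+1}-E_z^{\bar n}}{\Delta t}=\frac1{2\varepsilon}(\delta_xH_y^{\bar n}-\delta_yH_x^{n+1})|_{i,j,\bar k}$, $\frac{H_x^{n+1}-H_x^{\bar n}}{\Delta t}=\frac1{2\mu}(\delta_zE_y^{\bar n}-\delta_yE_z^{n+1})|_{i,\bar j,\bar k}$, $\frac{H_y^{n+1}-H_y^{\bar n}}{\Delta t}=\frac1{2\mu}(\delta_xE_z^{\bar n}-\delta_zE_x^{n+1})|_{\bar i,j,\bar k}$, $\frac{H_z^{n+1}-H_z^{\bar n}}{\Delta t}=\frac1{2\mu}(\delta_yE_x^{\bar n}-\delta_xE_y^{n+1})|_{\bar i,\bar j,k}$. The $\mathbf E$-equations hold at the E-points not lying on a face where that component is tangential (i.e. its integer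 indices are strictly between the endpoints); the $\mathbf H$-equations hold at all H-points. *Discrete PEC boundary condition*, for all integer and half-integer time levels $m$: $E_x^m=0$ if its $y$-index is $0$ or $J$ or its $z$-index is $0$ or $K$; $E_y^m=0$ if its $x$-index is $0$ or $I$ or its $z$-index is $0$ or $K$; $E_z^m=0$ if its $x$-index is $0$ or $I$ or its $y$-index is $0$ or $J$. *Initial condition*: $\mathbf E^0,\mathbf H^0$ are the values of $\mathbf E_0,\mathbf H_0$ at the respective grid points. **Errors.** $\mathcal E^n_w|_{\alpha,\beta,\gamma}=e_w(t^n,x_\alpha,y_\beta,z_\gamma)-E^n_w|_{\alpha,\beta,\gamma}$ at E-points, $\mathcal H^n_w|_{\alpha,\beta,\gamma}=h_w(t^n,x_\alpha,y_\beta,z_\gamma)-H^n_w|_{\alpha,\beta,\gamma}$ at H-points, $\mathcal E^n=(\mathcal E^n_x,\mathcal E^n_y,\mathcal E^n_z)$, $\mathcal H^n=(\mathcal H^n_x,\mathcal H^n_y,\mathcal H^n_z)$. **Norms.** The weight $P(\cdot)$ equals $\varepsilon$ for grid functions obtained from the electric field (error), and $\mu$ for those obtained from the magnetic field (error). For $\mathbf U$ on E-points and $\mathbf V$ on H-points, $$\|\mathbf U\|_E^2=\Delta v\,P(\mathbf U)\Big[\sum_{i=0}^{I-1}\sum_{j=1}^{J-1}\sum_{k=1}^{K-1}U_x^2|_{\bar i,j,k}+\sum_{i=1}^{I-1}\sum_{j=0}^{J-1}\sum_{k=1}^{K-1}U_y^2|_{i,\bar j,k}+\sum_{i=1}^{I-1}\sum_{j=1}^{J-1}\sum_{k=0}^{K-1}U_z^2|_{i,j,\bar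 k}\Big],$$ $$\|\mathbf V\|_H^2=\Delta v\,P(\mathbf V)\Big[\sum_{i=0}^{I}\sum_{j=0}^{J-1}\sum_{k=0}^{K-1}V_x^2|_{i,\bar j,\bar k}+\sum_{i=0}^{I-1}\sum_{j=0}^{J}\sum_{k=0}^{K-1}V_y^2|_{\bar i,j,\bar k}+\sum_{i=0}^{I-1}\sum_{j=0}^{J-1}\sum_{k=0}^{K}V_z^2|_{\bar i,\bar j,k}\Big].$$ *)

(* Defs.v *)
From mathcomp Require Import all_boot all_order all_algebra.
From mathcomp Require Import all_classical all_reals all_analysis.

Set Implicit Arguments.
Unset Strict Implicit.
Unset Printing Implicit Defensive.

Import Order.TTheory GRing.Theory Num.Theory.
Import numFieldNormedType.Exports.

Local Open Scope classical_set_scope.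
Local Open Scope ring_scope.

Notation vec3 A := (A * A * A)%type.
Definition cx {A : Type} (u : vec3 A) : A := u.1.1.
Definition cy {A : Type} (u : vec3 A) : A := u.1.2.
Definition cz {A : Type} (u : vec3 A) : A := u.2.
Definition map3 {A B : Type} (f : A -> B) (u : vec3 A) : vec3 B :=
  (f (cx u), f (cy u), f (cz u)).

Definition dot3 {R : realType} (a b : vec3 R) : R :=
  cx a * cx b + cy a * cy b + cz a * cz b.
Definition cross3 {R : realType} (a b : vec3 R) : vec3 R :=
  (cy a * cz b - cz a * cy b,
   cz a * cx b - cx a * cz b,
   cx a * cy b - cy a * cx b).

(* The library's [derivable] and ['D_v f a], with the increments restricted to
   those that stay in the closed set A: the derivative is one-sided at boundary
   points, and the values of f outside A are never used (for a in A). *)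
Definition derivable_in {R : realType} {V W : normedModType R}
    (A : set V) (f : V -> W) (a v : V) : Prop :=
  cvg ((fun h : R => h^-1 *: (f (h *: v + a) - f a))
         @ within [set h : R | A (h *: v + a)] 0^').
Definition derive_in {R : realType} {V W : normedModType R}
    (A : set V) (f : V -> W) (a v : V) : W :=
  lim ((fun h : R => h^-1 *: (f (h *: v + a) - f a))
         @ within [set h : R | A (h *: v + a)] 0^').

Section Continuous.
Context {R : realType}.
Implicit Types (f : vec3 R -> vec3 R) (u v : R -> vec3 R -> vec3 R).

Definition Omega : set (vec3 R) :=
  [set p | 0 <= cx p <= 1 /\ 0 <= cy p <= 1 /\ 0 <= cz p <= 1].

Definition unit_x : vec3 R := (1, 0, 0).
Definition unit_y : vec3 R := (0, 1, 0).
Definition unit_z : vec3 R := (0, 0, 1).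
Definition is_axis (a : vec3 R) : Prop := [\/ a = unit_x, a = unit_y | a = unit_z].

Definition partial (a : vec3 R) f : vec3 R -> vec3 R :=
  fun p => derive_in Omega f p a.

(* f belongs to C^k of the closed cube. *)
Fixpoint Ck (k : nat) f : Prop :=
  {within Omega, continuous f} /\
  (if k is l.+1 then
     forall a, is_axis a ->
       (forall p, Omega p -> derivable_in Omega f p a) /\ Ck l (partial a f)
   else True).

(* For f in C^k: the C^k norm of f, i.e. the supremum over the cube of the norms
   of all partial derivatives of order at most k, is at most r. *)
Fixpoint Ck_norm_le (k : nat) f (r : R) : Prop :=
  (forall p, Omega p -> `|f p| <= r) /\
  (if k is l.+1 then forall a, is_axis a -> Ck_norm_le l (partial a f) r
   else True).

Definition time_continuous (T : R) (k : nat) u : Prop :=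
  (forall t, 0 <= t <= T -> Ck k (u t)) /\
  (forall t, 0 <= t <= T -> forall r : R, 0 < r ->
     \forall s \near within `[0, T] (nbhs t),
       Ck_norm_le k (fun p => u s p - u t p) r).

Definition time_derivative (T : R) (k : nat) u v : Prop :=
  forall t, 0 <= t <= T -> forall r : R, 0 < r ->
    \forall s \near within `[0, T] t^',
      Ck_norm_le k (fun p => (s - t)^-1 *: (u s p - u t p) - v t p) r.

(* u belongs to C^m([0,T]; C^k(Omega)), as a map from [0,T] to the normed
   space C^k(Omega). *)
Fixpoint CmCk (T : R) (m k : nat) u : Prop :=
  time_continuous T k u /\
  (if m is l.+1 then exists v, time_derivative T k u v /\ CmCk T l k v
   else True).

Definition curl f (p : vec3 R) : vec3 R :=
  (cz (partial unit_y f p) - cy (partial unit_z f p),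
   cx (partial unit_z f p) - cz (partial unit_x f p),
   cy (partial unit_x f p) - cx (partial unit_y f p)).

Definition maxwell (T eps mu : R) u v : Prop :=
  forall t p, 0 < t <= T -> Omega p ->
    eps *: derive_in `[0, T] (u ^~ p) t 1 = curl (v t) p /\
    mu *: derive_in `[0, T] (v ^~ p) t 1 = - curl (u t) p.

(* p lies on the closed face of the cube whose outward normal is n; a point on
   an edge or at a corner lies on several faces. *)
Definition on_face (n p : vec3 R) : Prop :=
  Omega p /\
  ((n = - unit_x /\ cx p = 0) \/ (n = unit_x /\ cx p = 1) \/
   (n = - unit_y /\ cy p = 0) \/ (n = unit_y /\ cy p = 1) \/
   (n = - unit_z /\ cz p = 0) \/ (n = unit_z /\ cz p = 1)).

Definition pec (T : R) u v : Prop :=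
  forall t n p, 0 < t <= T -> on_face n p ->
    cross3 n (u t p) = 0 /\ dot3 n (v t p) = 0.

End Continuous.

(* Scalar space-time grid functions.  All indices are doubled: [U m a b c] is
   the value at time index m/2 and spatial index (a/2, b/2, c/2), so odd
   arguments are the half-integer indices. *)
Definition gridfun (R : realType) := nat -> nat -> nat -> nat -> R.

Definition int_idx (l : nat) : nat := l.*2.
Definition half_idx (l : nat) : nat := l.*2.+1.

Section Discrete.
Context {R : realType}.
Implicit Types (M : vec3 nat) (U : gridfun R) (V E H : vec3 (gridfun R)).

(* M = (I, J, K) *)
Definition step M : vec3 R := map3 (fun n : nat => n%:R^-1) M.

Definition node M (a b c : nat) : vec3 R :=
  (a%:R / 2 * cx (step M), b%:R / 2 * cy (step M), c%:R / 2 * cz (step M)).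
Definition instant (dt : R) (m : nat) : R := m%:R / 2 * dt.

(* A shift by 1 of a doubled index is a shift by 1/2.  The truncation
   0.-1 = 0 is immaterial: the differenced index is never 0 below. *)
Definition delta_x M U : gridfun R :=
  fun m a b c => (U m a.+1 b c - U m a.-1 b c) / cx (step M).
Definition delta_y M U : gridfun R :=
  fun m a b c => (U m a b.+1 c - U m a b.-1 c) / cy (step M).
Definition delta_z M U : gridfun R :=
  fun m a b c => (U m a b c.+1 - U m a b c.-1) / cz (step M).
Definition delta_t (dt : R) U : gridfun R :=
  fun m a b c => (U m.+1 a b c - U m.-1 a b c) / dt.

Definition delta1h M V : vec3 (gridfun R) :=
  (delta_y M (cz V), delta_z M (cx V), delta_x M (cy V)).
Definition delta2h M V : vec3 (gridfun R) :=
  (delta_z M (cy V), delta_x M (cz V), delta_y M (cx V)).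

Definition normE2 M (P : R) V (m : nat) : R :=
  cx (step M) * cy (step M) * cz (step M) * P *
  (\sum_(0 <= i < cx M) \sum_(1 <= j < cy M) \sum_(1 <= k < cz M)
      cx V m (half_idx i) (int_idx j) (int_idx k) ^+ 2
   + \sum_(1 <= i < cx M) \sum_(0 <= j < cy M) \sum_(1 <= k < cz M)
      cy V m (int_idx i) (half_idx j) (int_idx k) ^+ 2
   + \sum_(1 <= i < cx M) \sum_(1 <= j < cy M) \sum_(0 <= k < cz M)
      cz V m (int_idx i) (int_idx j) (half_idx k) ^+ 2).

Definition normH2 M (P : R) V (m : nat) : R :=
  cx (step M) * cy (step M) * cz (step M) * P *
  (\sum_(0 <= i < (cx M).+1) \sum_(0 <= j < cy M) \sum_(0 <= k < cz M)
      cx V m (int_idx i) (half_idx j) (half_idx k) ^+ 2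
   + \sum_(0 <= i < cx M) \sum_(0 <= j < (cy M).+1) \sum_(0 <= k < cz M)
      cy V m (half_idx i) (int_idx j) (half_idx k) ^+ 2
   + \sum_(0 <= i < cx M) \sum_(0 <= j < cy M) \sum_(0 <= k < (cz M).+1)
      cz V m (half_idx i) (half_idx j) (int_idx k) ^+ 2).

(* P holds at all points of the staggered grid of the given component; for the
   [interior] versions, at those not on a face where it is tangential. *)
Definition on_Ex M (P : nat -> nat -> nat -> Prop) : Prop :=
  forall i j k : nat, (i < cx M)%N -> (j <= cy M)%N -> (k <= cz M)%N ->
    P (half_idx i) (int_idx j) (int_idx k).
Definition on_Ey M (P : nat -> nat -> nat -> Prop) : Prop :=
  forall i j k : nat, (i <= cx M)%N -> (j < cy M)%N -> (k <= cz M)%N ->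
    P (int_idx i) (half_idx j) (int_idx k).
Definition on_Ez M (P : nat -> nat -> nat -> Prop) : Prop :=
  forall i j k : nat, (i <= cx M)%N -> (j <= cy M)%N -> (k < cz M)%N ->
    P (int_idx i) (int_idx j) (half_idx k).
Definition on_Hx M (P : nat -> nat -> nat -> Prop) : Prop :=
  forall i j k : nat, (i <= cx M)%N -> (j < cy M)%N -> (k < cz M)%N ->
    P (int_idx i) (half_idx j) (half_idx k).
Definition on_Hy M (P : nat -> nat -> nat -> Prop) : Prop :=
  forall i j k : nat, (i < cx M)%N -> (j <= cy M)%N -> (k < cz M)%N ->
    P (half_idx i) (int_idx j) (half_idx k).
Definition on_Hz M (P : nat -> nat -> nat -> Prop) : Prop :=
  forall i j k : nat, (i < cx M)%N -> (j < cy M)%N -> (k <= cz M)%N ->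
    P (half_idx i) (half_idx j) (int_idx k).
Definition interior_Ex M (P : nat -> nat -> nat -> Prop) : Prop :=
  forall i j k : nat, (i < cx M)%N -> (0 < j < cy M)%N -> (0 < k < cz M)%N ->
    P (half_idx i) (int_idx j) (int_idx k).
Definition interior_Ey M (P : nat -> nat -> nat -> Prop) : Prop :=
  forall i j k : nat, (0 < i < cx M)%N -> (j < cy M)%N -> (0 < k < cz M)%N ->
    P (int_idx i) (half_idx j) (int_idx k).
Definition interior_Ez M (P : nat -> nat -> nat -> Prop) : Prop :=
  forall i j k : nat, (0 < i < cx M)%N -> (0 < j < cy M)%N -> (k < cz M)%N ->
    P (int_idx i) (int_idx j) (half_idx k).

Definition adi_stage1 M (dt eps mu : R) E H (n : nat) : Prop :=
  let m0 := int_idx n in let m1 := half_idx n in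
  interior_Ex M (fun a b c =>
    (cx E m1 a b c - cx E m0 a b c) / dt = (2 * eps)^-1 *
      (delta_y M (cz H) m1 a b c - delta_z M (cy H) m0 a b c)) /\
  interior_Ey M (fun a b c =>
    (cy E m1 a b c - cy E m0 a b c) / dt = (2 * eps)^-1 *
      (delta_z M (cx H) m1 a b c - delta_x M (cz H) m0 a b c)) /\
  interior_Ez M (fun a b c =>
    (cz E m1 a b c - cz E m0 a b c) / dt = (2 * eps)^-1 *
      (delta_x M (cy H) m1 a b c - delta_y M (cx H) m0 a b c)) /\
  on_Hx M (fun a b c =>
    (cx H m1 a b c - cx H m0 a b c) / dt = (2 * mu)^-1 *
      (delta_z M (cy E) m1 a b c - delta_y M (cz E) m0 a b c)) /\
  on_Hy M (fun a b c =>
    (cy H m1 a b c - cy H m0 a b c) / dt = (2 * mu)^-1 *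
      (delta_x M (cz E) m1 a b c - delta_z M (cx E) m0 a b c)) /\
  on_Hz M (fun a b c =>
    (cz H m1 a b c - cz H m0 a b c) / dt = (2 * mu)^-1 *
      (delta_y M (cx E) m1 a b c - delta_x M (cy E) m0 a b c)).

Definition adi_stage2 M (dt eps mu : R) E H (n : nat) : Prop :=
  let m1 := half_idx n in let m2 := int_idx n.+1 in
  interior_Ex M (fun a b c =>
    (cx E m2 a b c - cx E m1 a b c) / dt = (2 * eps)^-1 *
      (delta_y M (cz H) m1 a b c - delta_z M (cy H) m2 a b c)) /\
  interior_Ey M (fun a b c =>
    (cy E m2 a b c - cy E m1 a b c) / dt = (2 * eps)^-1 *
      (delta_z M (cx H) m1 a b c - delta_x M (cz H) m2 a b c)) /\
  interior_Ez M (fun a b c =>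
    (cz E m2 a b c - cz E m1 a b c) / dt = (2 * eps)^-1 *
      (delta_x M (cy H) m1 a b c - delta_y M (cx H) m2 a b c)) /\
  on_Hx M (fun a b c =>
    (cx H m2 a b c - cx H m1 a b c) / dt = (2 * mu)^-1 *
      (delta_z M (cy E) m1 a b c - delta_y M (cz E) m2 a b c)) /\
  on_Hy M (fun a b c =>
    (cy H m2 a b c - cy H m1 a b c) / dt = (2 * mu)^-1 *
      (delta_x M (cz E) m1 a b c - delta_z M (cx E) m2 a b c)) /\
  on_Hz M (fun a b c =>
    (cz H m2 a b c - cz H m1 a b c) / dt = (2 * mu)^-1 *
      (delta_y M (cx E) m1 a b c - delta_x M (cy E) m2 a b c)).

Definition discrete_pec M (N : nat) E : Prop :=
  forall m : nat, (m <= int_idx N)%N ->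
  on_Ex M (fun a b c =>
    [\/ b = 0%N, b = int_idx (cy M), c = 0%N | c = int_idx (cz M)] ->
    cx E m a b c = 0) /\
  on_Ey M (fun a b c =>
    [\/ a = 0%N, a = int_idx (cx M), c = 0%N | c = int_idx (cz M)] ->
    cy E m a b c = 0) /\
  on_Ez M (fun a b c =>
    [\/ a = 0%N, a = int_idx (cx M), b = 0%N | b = int_idx (cy M)] ->
    cz E m a b c = 0).

Definition discrete_init M (E0 H0 : vec3 R -> vec3 R) E H : Prop :=
  on_Ex M (fun a b c => cx E 0%N a b c = cx (E0 (node M a b c))) /\
  on_Ey M (fun a b c => cy E 0%N a b c = cy (E0 (node M a b c))) /\
  on_Ez M (fun a b c => cz E 0%N a b c = cz (E0 (node M a b c))) /\
  on_Hx M (fun a b c => cx H 0%N a b c = cx (H0 (node M a b c))) /\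
  on_Hy M (fun a b c => cy H 0%N a b c = cy (H0 (node M a b c))) /\
  on_Hz M (fun a b c => cz H 0%N a b c = cz (H0 (node M a b c))).

Definition adi_fdtd M (N : nat) (dt eps mu : R) (E0 H0 : vec3 R -> vec3 R)
    E H : Prop :=
  [/\ discrete_init M E0 H0 E H,
      discrete_pec M N E
    & forall n : nat, (n < N)%N ->
        adi_stage1 M dt eps mu E H n /\ adi_stage2 M dt eps mu E H n].

Definition grid_error M (dt : R) (u : R -> vec3 R -> vec3 R) V :
    vec3 (gridfun R) :=
  (fun m a b c => cx (u (instant dt m) (node M a b c)) - cx V m a b c,
   fun m a b c => cy (u (instant dt m) (node M a b c)) - cy V m a b c,
   fun m a b c => cz (u (instant dt m) (node M a b c)) - cz V m a b c).

End Discrete.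

(* Main.v *)
Require Import Defs.
From HB Require Import structures.
From mathcomp Require Import all_boot all_order all_algebra.
From mathcomp Require Import all_classical all_reals all_analysis.
From mathcomp Require Import ring lra.

Set Implicit Arguments.
Unset Strict Implicit.
Unset Printing Implicit Defensive.

Import Order.TTheory GRing.Theory Num.Theory.
Import numFieldNormedType.Exports.
Local Open Scope classical_set_scope.
Local Open Scope ring_scope.

(** Split the discrete curl, weighted by [1/eps] and [1/mu], into the part
    [curlA] taken at the half step in both stages and the part [curlB] taken at
    the integer times. With [tau = dt/2] the two stages read
      [(1 - tau A) u* = (1 + tau B) u^n],
      [(1 - tau B) u^(n+1) = (1 + tau A) u*].
    For the weighted inner product both [A] and [B] are skew on states
    satisfying the discrete boundary condition ([curlA_skew], [curlB_skew]:
    summation by parts), so that [1 + tau A] and [1 - tau A] are equally long on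
    each state, and likewise for [B]; the number
      [energy v = |v|^2 + tau^2 |B v|^2 = |(1 + tau B) v|^2]
    is conserved by the scheme, and it is exactly the left-hand side of the two
    estimates ([norms_energy]).

    The intermediate value can be eliminated: subtracting the stages gives
      [u* = (u^n + u^(n+1))/2 - tau/2 B (u^(n+1) - u^n)].
    Putting the exact solution into this formula rather than comparing [u*]
    with a value of the exact solution, both stages acquire the same defect
    [tau * residual], where
      [residual = (u^(n+1) - u^n)/dt - (A + B)(u^n + u^(n+1))/2
                  + dt/4 A B (u^(n+1) - u^n)].
    The first two terms are a trapezoidal rule in time and central differences in
    space, the last is [dt^2] times a mixed second space difference of a
    difference quotient in time, up to a constant: all are of second order
    ([truncation]). The formula for [u*]
    does not apply on the faces where the electric field is tangential; there
    [u*] is zero, which agrees with the formula because the normal component of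
    the magnetic field vanishes on the whole face ([intermediate_formula]).
    The first estimate follows from the energy argument ([energy_bound]).

    Everything is linear and has constant coefficients in time, so the
    difference quotients [(err^(n+1) - err^n)/dt] satisfy the same recurrence,
    with the residual of the difference quotient in time of the exact solution.
    The same truncation estimate applies to it as soon as its third space
    derivatives are bounded uniformly in [dt], that is, as soon as third space
    derivatives of the solution are Lipschitz in time; this holds because fourth
    space derivatives are bounded and time derivatives are curls
    ([field_time_lipschitz3]). For the initial value, [err^0 = 0] makes the first
    error of size [dt * residual], so that its quotient by [dt] is again of
    second order.

    The analytic input, collected in [maxwell_field], consists of bounds on the
    space derivatives of order at most four, uniform in time ([time_bounded]), of
    the time derivatives of those of order at most two, given by the Maxwell
    equations, and of the boundary condition. *)

(** * Taylor expansions on an interval *)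

Section OneVariable.
Context {R : realType}.
Implicit Types (f g : R -> R) (a b x y M : R).

(** The hypotheses of the mean value theorem. In time they hold on the closed
    interval, although the Maxwell equations start at positive times. *)
Definition derives_on a b f f' : Prop :=
  {within `[a, b], continuous f} /\
  forall x, a < x < b -> is_derive x 1 f (f' x).

Lemma derives_on_of_eps a b f f' :
  (forall x, a <= x <= b -> forall e : R, 0 < e -> exists2 d : R, 0 < d &
     forall y, a <= y <= b -> `|y - x| < d -> `|f y - f x| <= e) ->
  (forall x, a < x < b -> forall e : R, 0 < e -> exists2 d : R, 0 < d &
     forall y, a <= y <= b -> `|y - x| < d ->
       `|f y - f x - (y - x) * f' x| <= e * `|y - x|) ->
  derives_on a b f f'.
Proof.
move=> Hc Hd; split.
  apply/subspace_continuousP => x /=; rewrite in_itv /= => xab.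
  apply/cvgrPdist_le => e e0; have [d d0 H] := Hc x xab e e0.
  rewrite near_withinE; near=> y => /=; rewrite in_itv /= => yab.
  change (`|f x - f y| <= e); rewrite distrC; apply: H => //.
move=> x xab.
suff H : (fun h : R => h^-1 *: (f (h *: 1 + x) - f x)) @ 0^' --> f' x.
  by split; [apply/cvg_ex; exists (f' x)|apply/cvg_lim].
apply/cvgrPdist_le => e e0; have [d d0 H] := Hd x xab e e0.
near=> h.
have hn0 : h != 0 by near: h; exact: nbhs_dnbhs_neq.
have hb : `|h| < Num.min d (Num.min (x - a) (b - x)).
  near: h; apply: dnbhs0_lt; rewrite !lt_min d0 /=; lra.
move: hb; rewrite !lt_min => /andP[hd /andP[ha hb]].
rewrite scaler1.
have E : h + x - x = h by rewrite addrK.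
have := H (h + x); rewrite E => /(_ _ hd) H'.
have {H'} H' : `|f (h + x) - f x - h * f' x| <= e * `|h|.
  apply: H'; move: ha hb; rewrite !ltr_norml; lra.
have h0 : 0 < `|h| by rewrite normr_gt0.
rewrite -(ler_pM2l h0) -normrM mulrBr /GRing.scale /= mulrA divff// mul1r.
by rewrite distrC [leRHS]mulrC.
Unshelve. all: by end_near. Qed.

Lemma derives_on_of_differentiable a b f f' :
  (forall x, a <= x <= b -> forall e : R, 0 < e -> exists2 d : R, 0 < d &
     forall y, a <= y <= b -> `|y - x| < d ->
       `|f y - f x - (y - x) * f' x| <= e * `|y - x|) ->
  derives_on a b f f'.
Proof.
move=> H; apply: derives_on_of_eps => x xab e e0; last by apply: H => //; lra.
have [r r0 {}H] := H x xab 1 ltr01.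
have l1 : 0 < `|f' x| + 1 by have := normr_ge0 (f' x); lra.
exists (Num.min r (e / (`|f' x| + 1))); first by rewrite lt_min r0 divr_gt0.
move=> y yab; rewrite lt_min => /andP[yr ye].
have := H y yab yr; rewrite mul1r => A.
have -> : f y - f x = (f y - f x - (y - x) * f' x) + (y - x) * f' x by ring.
apply: le_trans (ler_normD _ _) _; rewrite normrM.
have : `|y - x| * (`|f' x| + 1) < e by rewrite -ltr_pdivlMr.
lra.
Qed.

Lemma derives_on_shift a b a' b' c f f' : derives_on a b f f' -> a <= a' + c -> b' + c <= b ->
  derives_on a' b' (fun x => f (x + c)) (fun x => f' (x + c)).
Proof.
move=> [cf df] ha hb; split; last first.
  move=> x xab; have Df : is_derive (x + c) 1 f (f' (x + c)) by apply: df; lra.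
  have := @is_derive1_comp R f (fun y => y + c) x _ 1 Df; rewrite mulr1; apply.
  by apply: is_derive_eq; rewrite addr0.
move: cf => /subspace_continuousP cf; apply/subspace_continuousP => x /=.
rewrite in_itv /= => xab.
have : a <= x + c <= b by lra.
move=> xcab; have {}cf : f @ within `[a, b] (nbhs (x + c)) --> f (x + c).
  by apply: cf => /=; rewrite in_itv.
apply/cvgrPdist_le => e e0; move/cvgrPdist_le: cf => /(_ e e0).
rewrite !near_withinE => -[r /= r0 H]; exists r => // y /= yr.
rewrite in_itv /= => yab; apply: H => /=; last by rewrite in_itv /=; lra.
by rewrite opprD addrACA subrr addr0.
Qed.

Lemma derives_on_lincomb a b f f' g g' (c d : R) : derives_on a b f f' -> derives_on a b g g' ->
  derives_on a b (fun x => c * f x + d * g x) (fun x => c * f' x + d * g' x).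
Proof.
move=> [cf df] [cg dg]; split.
  move: cf cg => /subspace_continuousP cf /subspace_continuousP cg.
  apply/subspace_continuousP => x xab.
  by apply: cvgD; apply: cvgMr; [exact: cf|exact: cg].
move=> x xab; have Df := df x xab; have Dg := dg x xab.
have := @is_deriveD R R R (c \*: f) (d \*: g) x 1 _ _ (is_deriveZ c Df) (is_deriveZ d Dg).
by [].
Qed.

Lemma derives_on_ext a b f g f' g' : f =1 g -> (forall x, a < x < b -> f' x = g' x) ->
  derives_on a b f f' -> derives_on a b g g'.
Proof.
move=> /funext -> E [cf df]; split=> // x xab; rewrite -E//; exact: df.
Qed.

Lemma derives_on_half_sqr a b x : derives_on a b (fun y => (y - x) ^+ 2 / 2) (fun y => y - x).
Proof.
split.
  apply: continuous_subspaceT => z.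
  rewrite /continuous_at; under eq_fun do rewrite expr2.
  rewrite expr2; apply: cvgMl; apply: cvgM;
    by apply: cvgB; [exact: cvg_id|exact: cvg_cst].
move=> y yab; apply: is_derive_eq.
by rewrite /GRing.scale /=; field.
Qed.

Lemma derives_on_affine a b x : derives_on a b (fun y => y - x) (fun _ => 1).
Proof.
split.
  apply: continuous_subspaceT => z.
  by apply: cvgB; [exact: cvg_id|exact: cvg_cst].
move=> y yab; apply: is_derive_eq; ring.
Qed.

Lemma mean_value_le a b f f' x y M : derives_on a b f f' ->
  a <= x <= b -> a <= y <= b ->
  (forall z, a < z < b -> `|z - x| <= `|y - x| -> `|f' z| <= M) ->
  `|f y - f x| <= M * `|y - x|.
Proof.
move=> [cf df] xab yab HM.
have sub u v : a <= u <= b -> a <= v <= b ->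
    {within `[u, v], continuous f} /\
    forall z, z \in `]u, v[ -> is_derive z 1 f (f' z).
  move=> uab vab; split.
    apply: continuous_subspaceW cf => z /=; rewrite !in_itv /=; lra.
  move=> z; rewrite in_itv /= => zuv; apply: df; lra.
case: (ltgtP x y) => [xy|yx|->]; last by rewrite !subrr normr0 mulr0.
- have [c1 d1] := sub x y xab yab.
  have [c] := MVT xy d1 c1; rewrite in_itv /= => cxy ->.
  rewrite normrM ler_wpM2r//; apply: HM; first lra.
  by rewrite !gtr0_norm ?subr_gt0; lra.
- have [c1 d1] := sub y x yab xab.
  have [c] := MVT yx d1 c1; rewrite in_itv /= => cxy E.
  rewrite distrC E normrM (distrC x y) ler_wpM2r//; apply: HM; first lra.
  by rewrite !ltr0_norm ?subr_lt0; lra.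
Qed.

(** The remainders are stated with [f2] or [f3] merely bounded and with the
    constants of the iterated mean value inequality; [y] may lie on either side
    of [x]. *)
Lemma taylor_order1 a b f f' f2 x y M : derives_on a b f f' -> derives_on a b f' f2 ->
  (forall z, a < z < b -> `|f2 z| <= M) ->
  a <= x <= b -> a <= y <= b ->
  `|f y - f x - (y - x) * f' x| <= M * `|y - x| ^+ 2.
Proof.
move=> df df2 HM xab yab.
have := derives_on_lincomb 1 (- f' x) df (derives_on_affine a b x).
move/(@mean_value_le _ _ _ _ x y (M * `|y - x|)).
rewrite subrr !mulr0 addr0 !mul1r.
have -> : f y + - f' x * (y - x) - f x = f y - f x - (y - x) * f' x by ring.
rewrite expr2 mulrA; apply => // z zab zxy.
have zab' : a <= z <= b by lra.
have H : `|f' z - f' x| <= M * `|z - x|.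
  by apply: (mean_value_le df2 xab zab') => *; exact: HM.
have -> : 1 * f' z + - f' x * 1 = f' z - f' x by ring.
apply: le_trans H _; rewrite ler_wpM2l//.
exact: le_trans (HM z zab).
Qed.

Lemma taylor_order2 a b f f' f2 f3 x y M : derives_on a b f f' -> derives_on a b f' f2 ->
  derives_on a b f2 f3 -> (forall z, a < z < b -> `|f3 z| <= M) ->
  a <= x <= b -> a <= y <= b ->
  `|f y - f x - (y - x) * f' x - (y - x) ^+ 2 / 2 * f2 x|
    <= M * `|y - x| ^+ 3.
Proof.
move=> df df2 df3 HM xab yab.
have := derives_on_lincomb 1 (- f2 x) (derives_on_lincomb 1 (- f' x) df (derives_on_affine
  a b x)) (derives_on_half_sqr a b x).
move/(@mean_value_le _ _ _ _ x y (M * `|y - x| ^+ 2)).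
rewrite subrr expr0n /= mul0r !mulr0 !addr0 !mul1r.
have -> : f y + - f' x * (y - x) + - f2 x * ((y - x) ^+ 2 / 2) - f x =
  f y - f x - (y - x) * f' x - (y - x) ^+ 2 / 2 * f2 x by ring.
rewrite (_ : M * `|y - x| ^+ 3 = M * `|y - x| ^+ 2 * `|y - x|); last by rewrite exprSr mulrA.
apply => // z zab zxy.
have zab' : a <= z <= b by lra.
have := taylor_order1 df2 df3 HM xab zab'.
have -> : 1 * (1 * f' z + - f' x * 1) + - f2 x * (z - x) =
   f' z - f' x - (z - x) * f2 x by ring.
move=> H; apply: le_trans H _; rewrite ler_wpM2l//.
  exact: le_trans (HM z zab).
by rewrite lerXn2r ?nnegrE.
Qed.

(** The second-order terms of the two Taylor expansions cancel. *)
Lemma central_difference a b f f' f2 f3 x h M : derives_on a b f f' -> derives_on a b f' f2 ->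
  derives_on a b f2 f3 -> (forall z, a < z < b -> `|f3 z| <= M) -> 0 < h ->
  a <= x - h -> x + h <= b ->
  `|(f (x + h) - f (x - h)) / (2 * h) - f' x| <= M * h ^+ 2.
Proof.
move=> d1 d2 d3 HM h0 ha hb.
have xab : a <= x <= b by lra.
have pab : a <= x + h <= b by lra.
have mab : a <= x - h <= b by lra.
have := taylor_order2 d1 d2 d3 HM xab mab.
have := taylor_order2 d1 d2 d3 HM xab pab.
have -> : x + h - x = h by ring.
have -> : x - h - x = - h by ring.
rewrite normrN (gtr0_norm h0) => P Q.
rewrite -(ler_pM2l (_ : 0 < 2 * h)); last lra.
rewrite -[X in X * _ <= _]gtr0_norm; last lra.
rewrite -normrM.
have -> : (2 * h) * ((f (x + h) - f (x - h)) / (2 * h) - f' x) =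
  (f (x + h) - f x - h * f' x - h ^+ 2 / 2 * f2 x)
  - (f (x - h) - f x - - h * f' x - (- h) ^+ 2 / 2 * f2 x) by field; lra.
apply: le_trans (ler_normB _ _) _; rewrite (le_trans (lerD P Q))//.
by rewrite le_eqVlt; apply/orP; left; apply/eqP; ring.
Qed.

(** The quadratic term of the expansion of [f] is half of [h] times the linear
    term of the expansion of [f']. *)
Lemma trapezoid a b f f' f2 f3 x h M : derives_on a b f f' -> derives_on a b f' f2 ->
  derives_on a b f2 f3 -> (forall z, a < z < b -> `|f3 z| <= M) -> 0 < h ->
  a <= x -> x + h <= b ->
  `|(f (x + h) - f x) / h - (f' x + f' (x + h)) / 2| <= 2 * M * h ^+ 2.
Proof.
move=> d1 d2 d3 HM h0 ha hb.
have xab : a <= x <= b by lra.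
have pab : a <= x + h <= b by lra.
have := taylor_order1 d2 d3 HM xab pab.
have := taylor_order2 d1 d2 d3 HM xab pab.
have -> : x + h - x = h by ring.
rewrite (gtr0_norm h0) => P Q.
rewrite -(ler_pM2l h0) -[X in X * _ <= _](gtr0_norm h0) -normrM.
have -> : h * ((f (x + h) - f x) / h - (f' x + f' (x + h)) / 2) =
  (f (x + h) - f x - h * f' x - h ^+ 2 / 2 * f2 x)
  - (h / 2) * (f' (x + h) - f' x - h * f2 x) by field; lra.
apply: le_trans (ler_normB _ _) _.
rewrite [X in _ + X]normrM [X in _ + X * _]gtr0_norm; last lra.
have : h / 2 * `|f' (x + h) - f' x - h * f2 x| <= h / 2 * (M * h ^+ 2).
  by rewrite ler_pM2l//; lra.
have M0 : 0 <= M by apply: le_trans (HM (x + h / 2) _); [exact: normr_ge0|lra].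
have : 0 <= M * h ^+ 3 by rewrite mulr_ge0// exprn_ge0// ltW.
have -> : h / 2 * (M * h ^+ 2) = (M * h ^+ 3) / 2 by field.
have -> : h * (2 * M * h ^+ 2) = 2 * (M * h ^+ 3) by ring.
lra.
Qed.
End OneVariable.

(** * Iterated partial derivatives in the closed cube *)

Inductive dir := X | Y | Z.

Definition pr {A : Type} (d : dir) (u : vec3 A) : A :=
  match d with X => cx u | Y => cy u | Z => cz u end.
Definition upd {A : Type} (d : dir) (u : vec3 A) (a : A) : vec3 A :=
  match d with
  | X => (a, cy u, cz u) | Y => (cx u, a, cz u) | Z => (cx u, cy u, a)
  end.
Definition dir_eqb (c d : dir) : bool :=
  match c, d with X, X | Y, Y | Z, Z => true | _, _ => false end.
Lemma dir_eqbP : Equality.axiom dir_eqb.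
Proof. by case; case; constructor. Qed.
HB.instance Definition _ := hasDecEq.Build dir dir_eqbP.

Lemma pr_upd {A : Type} c d (u : vec3 A) a :
  pr c (upd d u a) = if c == d then a else pr c u.
Proof. by case: c; case: d. Qed.

Section SpatialDerivatives.
Context {R : realType}.
Implicit Types (p : vec3 R) (phi psi : vec3 R -> R) (f : vec3 R -> vec3 R).

Definition ax (d : dir) : vec3 R :=
  match d with X => unit_x | Y => unit_y | Z => unit_z end.

Lemma ax_axis d : is_axis (ax d).
Proof. by case: d; [apply: Or31|apply: Or32|apply: Or33]. Qed.

Lemma shiftE d p (h : R) : h *: ax d + p = upd d p (pr d p + h).
Proof.
by case: p => [[a b] c]; case: d;
  rewrite /ax /unit_x /unit_y /unit_z /upd /cx /cy /cz /=; congr (_, _, _);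
  rewrite /= /GRing.scale /= ?mulr1 ?mulr0 ?add0r // addrC.
Qed.

Lemma OmegaP p : Omega p <-> forall d, 0 <= pr d p <= 1.
Proof.
split=> [[? [? ?]] []//|H]; split; [exact: (H X)|split; [exact: (H Y)|exact: (H Z)]].
Qed.

Lemma Omega_upd d p x : Omega p -> 0 <= x <= 1 -> Omega (upd d p x).
Proof. by move=> /OmegaP Op x01; apply/OmegaP => c; rewrite pr_upd; case: ifP. Qed.

Lemma norm_pr c p : `|pr c p| <= `|p|.
Proof.
case: p => [[x y] z]; rewrite !prod_normE /=.
by case: c; rewrite /pr /cx /cy /cz /= !le_max lexx ?orbT.
Qed.

(** The increments stay in the cube, so the derivative is one-sided on the faces;
    it is required at all points of the closed cube because partial derivatives
    of higher order are again determined by the values in the closed cube. *)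
Definition has_partial d phi psi : Prop :=
  forall p, Omega p -> forall e : R, 0 < e -> exists2 r : R, 0 < r &
    forall h : R, `|h| < r -> Omega (upd d p (pr d p + h)) ->
      `|phi (upd d p (pr d p + h)) - phi p - h * psi p| <= e * `|h|.

(** Moving towards the farther of the two faces; this is what makes the one-sided
    derivatives unique. *)
Lemma admissible_shift d p (r : R) : Omega p -> 0 < r ->
  exists h : R, [/\ h != 0, `|h| < r & Omega (upd d p (pr d p + h))].
Proof.
move=> Op r0; have /OmegaP/(_ d)/andP[p0 p1] := Op.
set s := Num.min (r / 2) (1 / 2).
have s0 : 0 < s by rewrite lt_min; lra.
have sr : s < r by rewrite gt_min; apply/orP; left; lra.
have s1 : s <= 1 / 2 by rewrite ge_min lexx orbT.
have [ph|ph] := leP (pr d p) (1 / 2).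
- exists s; split; [by rewrite gt_eqF|by rewrite gtr0_norm|].
  by apply: Omega_upd => //; lra.
- exists (- s); split; [by rewrite oppr_eq0 gt_eqF|by rewrite normrN gtr0_norm|].
  by apply: Omega_upd => //; lra.
Qed.

Lemma has_partial_uniq d phi psi phi' psi' : (forall p, Omega p -> phi p = phi' p) ->
  has_partial d phi psi -> has_partial d phi' psi' -> forall p, Omega p -> psi p = psi' p.
Proof.
move=> E H1 H2 p Op; apply/eqP; rewrite -subr_eq0 -normr_le0; apply/ler_addgt0Pr => e e0.
rewrite add0r.
have e2 : 0 < e / 2 by lra.
have [r1 r10 {}H1] := H1 p Op _ e2.
have [r2 r20 {}H2] := H2 p Op _ e2.
have r0 : 0 < Num.min r1 r2 by rewrite lt_min r10.
have [h [h0]] := admissible_shift d Op r0; rewrite lt_min => /andP[h1 h2 Oh].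
have := H1 h h1 Oh; have := H2 h h2 Oh; rewrite !E// => A B.
rewrite -(ler_pM2l (_ : 0 < `|h|)) ?normr_gt0//.
rewrite -normrM.
have -> : h * (psi p - psi' p) =
  (phi' (upd d p (pr d p + h)) - phi' p - h * psi' p)
   - (phi' (upd d p (pr d p + h)) - phi' p - h * psi p) by ring.
apply: le_trans (ler_normB _ _) _; rewrite (le_trans (lerD A B))//; lra.
Qed.

Lemma has_partial_lincomb d (a b : R) phi psi phi' psi' : has_partial d phi psi ->
  has_partial d phi' psi' ->
  has_partial d (fun p => a * phi p + b * phi' p) (fun p => a * psi p + b * psi' p).
Proof.
move=> H1 H2 p Op e e0.
set k := `|a| + `|b| + 1.
have k0 : 0 < k by rewrite /k; have := normr_ge0 a; have := normr_ge0 b; lra.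
have ek : 0 < e / k by rewrite divr_gt0.
have [r1 r10 {}H1] := H1 p Op _ ek.
have [r2 r20 {}H2] := H2 p Op _ ek.
exists (Num.min r1 r2); first by rewrite lt_min r10.
move=> h; rewrite lt_min => /andP[h1 h2 Oh].
have := H1 h h1 Oh; have := H2 h h2 Oh => A B.
set q := upd _ _ _ in A B *.
have -> : a * phi q + b * phi' q - (a * phi p + b * phi' p)
    - h * (a * psi p + b * psi' p) =
  a * (phi q - phi p - h * psi p) + b * (phi' q - phi' p - h * psi' p) by ring.
apply: le_trans (ler_normD _ _) _; rewrite !normrM.
have := ler_wpM2l (normr_ge0 a) B; have := ler_wpM2l (normr_ge0 b) A.
have : 0 <= e / k * `|h| by rewrite mulr_ge0// ltW.
have : e * `|h| = k * (e / k * `|h|) by field; lra.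
rewrite /k; lra.
Qed.

Lemma has_partial_derives_on d phi psi p : has_partial d phi psi -> Omega p ->
  derives_on 0 1 (fun x => phi (upd d p x)) (fun x => psi (upd d p x)).
Proof.
move=> H Op.
have H' x e : 0 <= x <= 1 -> 0 < e -> exists2 r : R, 0 < r &
    forall y, 0 <= y <= 1 -> `|y - x| < r ->
     `|phi (upd d p y) - phi (upd d p x) - (y - x) * psi (upd d p x)|
       <= e * `|y - x|.
  move=> x01 e0; have [r r0 {}H] := H _ (Omega_upd d Op x01) e e0.
  exists r => // y y01 yx; have := H (y - x) yx.
  rewrite pr_upd eqxx (_ : x + (y - x) = y); last by ring.
  have -> : upd d (upd d p x) y = upd d p y by case: (d).
  by apply; exact: Omega_upd.
by apply: derives_on_of_differentiable => x x01 e e0; exact: H'.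
Qed.

Implicit Types F G : seq dir -> vec3 R -> R.

(** The head of a word is the derivative taken last. By [partial_tower_uniq] a
    tower is determined by its bottom, which reduces every computation of
    iterated partial derivatives to exhibiting a tower. *)
Definition partial_tower (k : nat) (F : seq dir -> vec3 R -> R) : Prop :=
  forall w d, (size w < k)%N -> has_partial d (F w) (F (d :: w)).

Lemma partial_tower_uniq k F G : partial_tower k F -> partial_tower k G ->
  (forall p, Omega p -> F [::] p = G [::] p) ->
  forall w, (size w <= k)%N -> forall p, Omega p -> F w p = G w p.
Proof.
move=> H H' E; elim=> [|d w IH] //= sw.
exact: has_partial_uniq (IH (ltnW sw)) (H w d sw) (H' w d sw).
Qed.

Definition partials (w : seq dir) f : vec3 R -> vec3 R :=
  foldr (fun d => partial (ax d)) f w.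

Lemma partials_rcons w d f : partials (rcons w d) f = partials w (partial (ax d) f).
Proof. by rewrite /partials foldr_rcons. Qed.

(** [Ck] and [Ck_norm_le] peel off the derivative taken first, which is the last
    letter of the word; hence the inductions from the end. *)
Lemma Ck_partials w k f : Ck (size w + k) f -> Ck k (partials w f).
Proof.
elim/last_ind: w f => [//|w d IH] f; rewrite size_rcons addSn partials_rcons.
by move=> [_ /(_ _ (ax_axis d))[_ /IH]].
Qed.

Lemma Ck_norm_partials w c k f (r : R) p : Ck_norm_le k f r -> (size w <= k)%N ->
  Omega p -> `|pr c (partials w f p)| <= r.
Proof.
elim/last_ind: w k f => [|w d IH] k f.
  by case: k => [|k] [H _] _ Op; apply: le_trans (norm_pr _ _) (H p Op).
case: k => [|k] [_ H]; rewrite size_rcons // ltnS => sw Op.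
by rewrite partials_rcons; apply: (IH k) => //; apply: H; exact: ax_axis.
Qed.

Lemma derivable_has_partial c d f :
  (forall p, Omega p -> derivable_in Omega f p (ax d)) ->
  has_partial d (fun p => pr c (f p)) (fun p => pr c (partial (ax d) f p)).
Proof.
move=> H p Op e e0; have := H p Op => /cvgrPdist_le/(_ e e0).
rewrite near_withinE near_withinE => -[r /= r0 {}H]; exists r => // h hr.
rewrite -shiftE => Oh.
have [->|h0] := eqVneq h 0.
  by rewrite scale0r add0r subrr mul0r subr0 normr0 mulr0.
have := H h; rewrite /ball_ /= sub0r normrN => /(_ hr h0 Oh).
rewrite -/(derive_in Omega f p (ax d)) -/(partial (ax d) f p).
move=> /(le_trans (norm_pr c _)).
have pr_lin (a b : vec3 R) : pr c (a - h^-1 *: b) = pr c a - h^-1 * pr c b.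
  by case: (c); case: a => -[? ?] ?; case: b => -[? ?] ?.
have pr_sub (a b : vec3 R) : pr c (a - b) = pr c a - pr c b.
  by case: (c); case: a => -[? ?] ?; case: b => -[? ?] ?.
rewrite pr_lin pr_sub => A.
rewrite -(ler_pM2r (_ : 0 < `|h|)) ?normr_gt0// -normrM in A.
have -> : pr c (f (h *: ax d + p)) - pr c (f p) - h * pr c (partial (ax d) f p)
  = - ((pr c (partial (ax d) f p)
        - h^-1 * (pr c (f (h *: ax d + p)) - pr c (f p))) * h) by field.
by rewrite normrN.
Qed.

Lemma Ck_le k l f : (k <= l)%N -> Ck l f -> Ck k f.
Proof.
elim: k l f => [|k IH] [|l] f //; first by move=> _ [].
by rewrite ltnS => kl [cf H]; split=> // a /H [? ?]; split=> //; exact: IH kl _.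
Qed.

Lemma Ck_partial_tower k f c : Ck k f -> partial_tower k (fun w p => pr c (partials w f p)).
Proof.
move=> H w d sw; apply: derivable_has_partial => p Op.
have : Ck 1 (partials w f) by apply: Ck_partials; apply: Ck_le H; rewrite addn1.
by move=> [_ /(_ _ (ax_axis d))[/(_ p Op)]].
Qed.
End SpatialDerivatives.

(** * Uniform bounds and time derivatives *)

Lemma derive_in_eq {R : realType} {V W : normedModType R} (A : set V)
    (f : V -> W) (a v : V) (l : W) :
  ProperFilter (within [set h : R | A (h *: v + a)] 0^') ->
  (fun h : R => h^-1 *: (f (h *: v + a) - f a))
     @ within [set h : R | A (h *: v + a)] 0^' --> l ->
  derive_in A f a v = l.
Proof. by move=> FF H; apply/cvg_lim. Qed.

Section LinearityOfPartials.
Context {R : realType}.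
Implicit Types (p a : vec3 R) (f g h F : vec3 R -> vec3 R).

Lemma Omega_filter d p : Omega p ->
  ProperFilter (within [set h : R | Omega (h *: ax d + p)] 0^').
Proof.
move=> Op; apply: Build_ProperFilter => -[r /= r0 H].
have [h [h0 hr Oh]] := admissible_shift d Op r0.
apply: (H h) => //=; first by rewrite sub0r normrN.
by rewrite shiftE.
Qed.

(** Three terms, because the hypotheses on time derivatives concern
    [(u s - u t) / (s - t) - v t]. The combination [F] carries no regularity of
    its own a priori; agreement on the cube suffices since the increments stay
    there. *)
Lemma partial_lin3 d p (x y z : R) F f g h : Omega p ->
  derivable_in Omega f p (ax d) -> derivable_in Omega g p (ax d) ->
  derivable_in Omega h p (ax d) ->
  (forall q, Omega q -> F q = x *: f q + y *: g q + z *: h q) ->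
  partial (ax d) F p =
    x *: partial (ax d) f p + y *: partial (ax d) g p + z *: partial (ax d) h p.
Proof.
move=> Op df dg dh E; have FF := Omega_filter d Op.
apply: derive_in_eq => //.
have L := cvgD (cvgD (cvgZl_tmp (k := x) df) (cvgZl_tmp (k := y) dg))
  (cvgZl_tmp (k := z) dh).
apply: cvg_trans (L _ _ _ _ _); apply: near_eq_cvg; rewrite near_withinE; near=> k => Ok.
rewrite !fctE /= !E//; case: (f _) (g _) (h _) => [[? ?] ?] [[? ?] ?] [[? ?] ?].
case: (f p) (g p) (h p) => [[? ?] ?] [[? ?] ?] [[? ?] ?].
congr (_, _, _); rewrite /= /GRing.scale /=; ring.
Unshelve. all: by end_near. Qed.

Lemma partials_lin3 k w p (x y z : R) F f g h : (size w <= k)%N ->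
  Ck k f -> Ck k g -> Ck k h ->
  (forall q, Omega q -> F q = x *: f q + y *: g q + z *: h q) -> Omega p ->
  partials w F p = x *: partials w f p + y *: partials w g p + z *: partials w h p.
Proof.
move=> sw cf cg ch E; elim: w sw p => [|d w IH] //= sw p Op.
have dD f' : Ck k f' -> derivable_in Omega (partials w f') p (ax d).
  move=> ck; have : Ck 1 (partials w f') by apply: Ck_partials; apply: Ck_le ck; rewrite addn1.
  by move=> [_ /(_ _ (ax_axis d))[/(_ p Op)]].
apply: partial_lin3 => //; [exact: dD|exact: dD|exact: dD|].
by move=> q Oq; apply: IH => //; exact: ltnW.
Qed.

Lemma compact_Omega : compact (@Omega R).
Proof.
have -> : @Omega R = (`[0, 1] `*` `[0, 1]) `*` `[0, 1].
  apply/seteqP; split => [[[x y] z]|[[x y] z]] /=; rewrite !in_itv /=.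
    by move=> [? [? ?]].
  by move=> [[? ?] ?].
by apply: compact_setX; [apply: compact_setX|]; exact: segment_compact.
Qed.

Lemma Ck_norm_le_mono k f (r s : R) : r <= s -> Ck_norm_le k f r -> Ck_norm_le k f s.
Proof.
move=> rs; elim: k f => [|k IH] f [H1 H2]; split=> //.
- by move=> p /H1 /le_trans; apply.
- by move=> p /H1 /le_trans; apply.
- by move=> a /H2 /IH.
Qed.

Lemma continuous_bounded f : {within Omega, continuous f} ->
  exists r : R, forall p, Omega p -> `|f p| <= r.
Proof.
move=> cf; have [r [_ /(_ (r + 1))]] :=
  compact_bounded (continuous_compact cf compact_Omega).
rewrite ltrDl ltr01 => /(_ isT) B; exists (r + 1) => p Op.
by apply: B; exists p.
Qed.

Lemma Ck_bounded k f : Ck k f -> exists r : R, Ck_norm_le k f r.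
Proof.
elim: k f => [|k IH] f [cf H]; have [r0 B0] := continuous_bounded cf.
  by exists r0; split.
have B d : exists r : R, Ck_norm_le k (partial (ax d) f) r.
  by apply: IH; apply: (H _ (ax_axis d)).2.
have [rx Bx] := B X; have [ry By] := B Y; have [rz Bz] := B Z.
exists (Num.max r0 (Num.max rx (Num.max ry rz))); split.
  by move=> p /B0 h; rewrite le_max h.
move=> a [] ->.
- by apply: Ck_norm_le_mono Bx; rewrite !le_max lexx ?orbT.
- by apply: Ck_norm_le_mono By; rewrite !le_max lexx ?orbT.
- by apply: Ck_norm_le_mono Bz; rewrite !le_max lexx ?orbT.
Qed.
End LinearityOfPartials.

Section TimeRegularity.
Context {R : realType}.
Implicit Types (p : vec3 R) (u v : R -> vec3 R -> vec3 R) (T : R).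

(** Near each time the derivatives differ by at most 1 from those at that time,
    which are bounded on the cube; conclude by compactness of the time
    interval. *)
Lemma time_bounded T k u : time_continuous T k u ->
  exists B : R, forall t w c p, 0 <= t <= T -> (size w <= k)%N -> Omega p ->
    `|pr c (partials w (u t) p)| <= B.
Proof.
move=> [Cu Nu].
have := @segment_compact R 0 T => /compact_near_coveringP.
move/(_ R +oo (fun B t => 0 <= t <= T -> forall w c p, (size w <= k)%N ->
  Omega p -> `|pr c (partials w (u t) p)| <= B) _).
case; last first.
  move=> B [_ H]; exists (B + 1) => t w c p tT sw Op.
  by apply: (H (B + 1)) => //=; rewrite ?ltrDl ?in_itv /=.
move=> t /=; rewrite in_itv /= => tT.
have [r Br] := Ck_bounded (Cu t tT).
have := Nu t tT 1 ltr01; rewrite near_withinE => Nt.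
exists ([set s | `[0, T]%classic s -> Ck_norm_le k (fun p => u s p - u t p) 1],
  [set B | r + 1 < B]); first by split=> //; exists (r + 1); split; rewrite ?num_real.
move=> [s B] [/= Hs HB] sT w c p sw Op.
have {}Hs : Ck_norm_le k (fun p => u s p - u t p) 1 by apply: Hs; rewrite in_itv.
have := Ck_norm_partials c Hs sw Op.
rewrite (@partials_lin3 _ k w p 1 (-1) 0 _ (u s) (u t) (u t))//; first last.
- by move=> q _; rewrite scale1r scaleN1r scale0r addr0.
- exact: Cu.
- exact: Cu.
- exact: Cu.
rewrite scale1r scaleN1r scale0r addr0 => A1.
have A2 := Ck_norm_partials c Br sw Op.
have E : pr c (partials w (u s) p) = pr c (partials w (u s) p - partials w (u t) p) + pr c
  (partials w (u t) p).
  case: (c); rewrite /pr /cx /cy /cz /=; ring.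
rewrite E; apply: le_trans (ler_normD _ _) _; lra.
Qed.

Lemma time_derivative_derives_on T k u v w c p : (forall t, 0 <= t <= T -> Ck k (u t)) ->
  (forall t, 0 <= t <= T -> Ck k (v t)) -> time_derivative T k u v ->
  (size w <= k)%N -> Omega p ->
  derives_on 0 T (fun t => pr c (partials w (u t) p)) (fun t => pr c (partials w (v t) p)).
Proof.
move=> Cu Cv H sw Op; apply: derives_on_of_differentiable => t tT e e0.
have := H t tT e e0; rewrite !near_withinE => -[r /= r0 {}H].
exists r => // s sT sr.
have [->|st] := eqVneq s t; first by rewrite !subrr mul0r subr0 normr0 mulr0.
have {}H : Ck_norm_le k (fun p => (s - t)^-1 *: (u s p - u t p) - v t p) e.
  by apply: H => //=; rewrite 1?distrC.
have := Ck_norm_partials c H sw Op.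
rewrite (@partials_lin3 _ k w p (s - t)^-1 (- (s - t)^-1) (-1) _ (u s) (u t) (v t))//;
  [|exact: Cu|exact: Cu|exact: Cv|by move=> q _; rewrite scalerBr scaleNr scaleN1r].
have st0 : s - t != 0 by rewrite subr_eq0.
rewrite -(ler_pM2r (_ : 0 < `|s - t|)) ?normr_gt0// -normrM.
congr (`|_| <= _).
by case: (c); rewrite /pr /cx /cy /cz /= /GRing.scale /=; field.
Qed.

Lemma time_derivative_derive_in T k u v t p : time_derivative T k u v ->
  0 < t < T -> Omega p -> derive_in `[0, T] (u ^~ p) t 1 = v t p.
Proof.
move=> H tT Op.
have FF : ProperFilter (within [set h : R | `[0, T]%classic (h *: 1 + t)] 0^').
  apply: Build_ProperFilter => -[r /= r0 {}H].
  set h := Num.min (r / 2) (T - t).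
  have h0 : 0 < h by rewrite lt_min; lra.
  have hT : h <= T - t by rewrite ge_min lexx orbT.
  have hr : h < r by rewrite gt_min; apply/orP; left; lra.
  apply: (H h) => /=; first by rewrite sub0r normrN gtr0_norm.
    by rewrite gt_eqF.
  by rewrite scaler1 in_itv /=; lra.
apply: derive_in_eq; apply/cvgrPdist_le => e e0.
have tT' : 0 <= t <= T by lra.
have := H t tT' e e0; rewrite !near_withinE => -[r /= r0 {}H].
exists r => // h /= hr h0; rewrite scaler1 => hT.
have : Ck_norm_le k (fun p => h^-1 *: (u (h + t) p - u t p) - v t p) e.
  rewrite -[h in h^-1](addrK t); apply: H => //=.
    by move: hr; rewrite sub0r normrN opprD addrCA subrr addr0 normrN.
  by rewrite -subr_eq0 addrK.
by case: (k) => [|l] [/(_ p Op)]; rewrite distrC.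
Qed.
End TimeRegularity.

(** * Fields satisfying the Maxwell equations *)

Definition nx (d : dir) : dir := match d with X => Y | Y => Z | Z => X end.
Definition pv (d : dir) : dir := match d with X => Z | Y => X | Z => Y end.
(** The fields are indexed by a boolean, [false] for the electric and [true] for
    the magnetic field. In the equation of component [d] of one field, the first
    stage is implicit in the derivative along [dirA] of component [dirB] of the
    other field, and explicit in the derivative along [dirB] of component
    [dirA]. *)
Definition dirA (f : bool) (d : dir) : dir := if f then pv d else nx d.
Definition dirB (f : bool) (d : dir) : dir := if f then nx d else pv d.

Section MaxwellFields.
Context {R : realType}.
Variable kap : bool -> R.
Hypothesis kap_gt0 : forall f, 0 < kap f.

(** Each component comes with its iterated space derivatives, indexed by words. *)
Definition field : Type := bool -> dir -> seq dir -> R -> vec3 R -> R.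
Implicit Types (U : field) (T M : R) (p : vec3 R).

(** The right-hand side of the Maxwell equations, including the factor [1/eps] or
    [1/mu] and the sign of the second equation. *)
Definition curl_field U : field := fun f d w t p =>
  kap f * (U (~~ f) (dirB f d) (rcons w (dirA f d)) t p
           - U (~~ f) (dirA f d) (rcons w (dirB f d)) t p).

(** This class, for varying [k], contains both the exact solution and its
    difference quotients in time; the truncation error needs [k = 3]. *)
Record maxwell_field (k : nat) T M U : Prop := MaxwellField {
  field_space : forall f d w a t, 0 <= t <= T -> (size w < k)%N ->
    has_partial a (U f d w t) (U f d (a :: w) t);
  field_bound : forall f d w t p, 0 <= t <= T -> (size w <= k)%N -> Omega p ->
    `|U f d w t p| <= M;
  field_time : forall f d w p, (size w <= 2)%N -> Omega p ->
    derives_on 0 T (fun t => U f d w t p) (fun t => curl_field U f d w t p);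
  field_pec : forall f d q t p, 0 <= t <= T -> Omega p ->
    pr q p = 0 \/ pr q p = 1 -> (d == q) = f -> U f d [::] t p = 0 }.

Lemma maxwell_field_le k l T M U : (k <= l)%N ->
  maxwell_field l T M U -> maxwell_field k T M U.
Proof.
move=> kl [H1 H2 H3 H4]; split=> //.
- by move=> f d w a t tT sw; apply: H1 => //; exact: leq_trans kl.
- by move=> f d w t p tT sw; apply: H2 => //; exact: leq_trans kl.
Qed.

Definition kap_sum : R := kap true + kap false.
Lemma kap_le f : kap f <= kap_sum.
Proof. by rewrite /kap_sum; have := kap_gt0 true; have := kap_gt0 false; case: f; lra. Qed.

Lemma curl_field_bound k T M U f d w t p : maxwell_field k T M U -> 0 <= t <= T ->
  (size w < k)%N -> Omega p -> `|curl_field U f d w t p| <= 2 * kap_sum * M.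
Proof.
move=> H tT sw Op.
rewrite /curl_field normrM gtr0_norm// (mulrC 2) -mulrA.
apply: ler_pM => //; [exact: ltW|exact: kap_le|].
apply: le_trans (ler_normB _ _) _.
have A := field_bound H (~~ f) (dirB f d) tT (w := rcons w (dirA f d)) _ Op.
have B := field_bound H (~~ f) (dirA f d) tT (w := rcons w (dirB f d)) _ Op.
rewrite !size_rcons in A B; have := A sw; have := B sw; lra.
Qed.

Lemma has_partial_curl k T M U f d w a t : maxwell_field k T M U -> 0 <= t <= T ->
  ((size w).+1 < k)%N -> has_partial a (curl_field U f d w t) (curl_field U f d (a :: w) t).
Proof.
move=> H tT sw; rewrite /curl_field.
have A := field_space H (~~ f) (dirB f d) (w := rcons w (dirA f d)) a tT.
have B := field_space H (~~ f) (dirA f d) (w := rcons w (dirB f d)) a tT.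
rewrite !size_rcons in A B.
have := has_partial_lincomb (kap f) (- kap f) (A sw) (B sw).
have E (x y : vec3 R -> R) : (fun p => kap f * x p + - kap f * y p) =
    (fun p => kap f * (x p - y p)) by apply/funext => p; ring.
by rewrite !E.
Qed.

Lemma has_partial_mean_value_le d (phi psi : vec3 R -> R) (L : R) p q : has_partial d phi psi ->
  (forall x, Omega x -> `|psi x| <= L) -> Omega p -> Omega q ->
  (forall c, c != d -> pr c q = pr c p) ->
  `|phi q - phi p| <= L * `|pr d q - pr d p|.
Proof.
move=> H HL Op Oq E.
have upd_id : upd d p (pr d p) = p by case: (d); case: (p) => -[].
have upd_q : upd d p (pr d q) = q.
  case: p q d {H Op Oq upd_id} E => [[? ?] ?] [[? ?] ?] [] E;
  move: (E X) (E Y) (E Z); rewrite /upd /pr /cx /cy /cz /= => EX EY EZ;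
  by congr (_, _, _); rewrite ?EX ?EY ?EZ.
have := mean_value_le (has_partial_derives_on H Op) (x := pr d p) (y := pr d q) (M := L).
rewrite upd_id upd_q; apply; [exact: (OmegaP _).1|exact: (OmegaP _).1|].
by move=> z z01 _; apply: HL; apply: Omega_upd => //; lra.
Qed.

Lemma field_time_lipschitz k T M U f d w s t p : maxwell_field k T M U ->
  0 <= s <= T -> 0 <= t <= T -> (size w <= 2)%N -> (size w < k)%N -> Omega p ->
  `|U f d w t p - U f d w s p| <= 2 * kap_sum * M * `|t - s|.
Proof.
move=> H sT tT sw swk Op.
apply: (mean_value_le (field_time H f d sw Op)) => // z zT _.
apply: (curl_field_bound f d H) => //; lra.
Qed.

(** The time derivatives at hand are those of space derivatives of order at most
    two. One more order is reached by estimating the mixed difference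
    [F(t,q) - F(s,q) - F(t,p) + F(s,p)] of a second derivative [F] through its
    time derivative, a third space derivative that is Lipschitz in space, then
    dividing by the distance of [p] and [q]. *)
Lemma field_time_lipschitz3 T M U f d w a s t p : maxwell_field 4 T M U ->
  0 <= s <= T -> 0 <= t <= T -> (size w <= 2)%N -> Omega p ->
  `|U f d (a :: w) t p - U f d (a :: w) s p| <= 2 * kap_sum * M * `|t - s|.
Proof.
move=> H sT tT sw Op; apply/ler_addgt0Pr => e e0.
have sw4 : (size w < 4)%N by exact: leq_ltn_trans sw _.
have W := has_partial_lincomb 1 (-1) (field_space H f d a tT sw4) (field_space H f d a sT sw4).
have [r r0 {}W] := W p Op e e0.
have [h [h0 hr Oh]] := admissible_shift a Op r0.
have := W h hr Oh; set q := upd a p _ in Oh *.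
rewrite !mul1r !mulN1r => A.
have B : `|(U f d w t q - U f d w s q) - (U f d w t p - U f d w s p)|
    <= 2 * kap_sum * M * `|h| * `|t - s|.
  have := mean_value_le (derives_on_lincomb 1 (-1) (field_time H f d sw Oh) (field_time H f
    d sw Op)).
  move=> /(_ s t (2 * kap_sum * M * `|h|) sT tT); rewrite !mul1r !mulN1r.
  have -> : U f d w t q - U f d w t p - (U f d w s q - U f d w s p) =
    (U f d w t q - U f d w s q) - (U f d w t p - U f d w s p) by ring.
  apply => z zT _; rewrite mul1r mulN1r.
  have zT' : 0 <= z <= T by lra.
  have := has_partial_mean_value_le (p := p) (q := q) (has_partial_curl f d a H zT' _) _ Op Oh.
  move=> /(_ w (2 * kap_sum * M)); rewrite /q pr_upd eqxx (addrC (pr a p)) addrK; apply.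
  - by rewrite !ltnS.
  - by move=> x Ox; apply: (curl_field_bound f d H).
  - by move=> c; rewrite pr_upd => /negPf ->.
have h1 : 0 < `|h| by rewrite normr_gt0.
rewrite -(ler_pM2l h1) -normrM.
set x := U f d (a :: w) t p - _ in A *.
set y := (_ - _ - (_ - _)) in B.
rewrite -/y in A.
have -> : h * x = y - (y - h * x) by ring.
apply: le_trans (ler_normB _ _) _.
rewrite -/x in A. lra.
Qed.

Definition time_quotient (h : R) U : field :=
  fun f d w t p => (U f d w (t + h) p - U f d w t p) / h.

(** One space derivative is lost, but the bound does not depend on the time
    step. *)
Lemma time_quotient_field T M U h : 0 < h -> maxwell_field 4 T M U ->
  maxwell_field 3 (T - h) (2 * kap_sum * M) (time_quotient h U).
Proof.
move=> h0 H; split.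
- move=> f d w a t tT sw.
  have t1 : 0 <= t + h <= T by lra.
  have t2 : 0 <= t <= T by lra.
  have := has_partial_lincomb h^-1 (- h^-1) (field_space H f d a t1 (ltnW sw)) (field_space
    H f d a t2 (ltnW sw)).
  congr has_partial; apply/funext => p; rewrite /time_quotient; ring.
- move=> f d w t p tT sw Op.
  have t1 : 0 <= t + h <= T by lra.
  have t2 : 0 <= t <= T by lra.
  rewrite /time_quotient normrM normfV (gtr0_norm h0) ler_pdivrMr//.
  have hE : h = `|t + h - t| by rewrite addrAC subrr add0r gtr0_norm.
  rewrite [in X in _ <= X]hE.
  case: w sw => [|a w] sw; first exact: (field_time_lipschitz f d H).
  exact: (field_time_lipschitz3 f d a H).
- move=> f d w p sw Op.
  have H1 := field_time H f d sw Op.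
  have := @derives_on_shift _ _ _ 0 (T - h) h _ _ H1; rewrite add0r subrK.
  move=> /(_ (ltW h0) (lexx T)) D1.
  have := @derives_on_shift _ _ _ 0 (T - h) 0 _ _ H1; rewrite add0r addr0.
  move=> /(_ (lexx 0)) D2.
  have := derives_on_lincomb h^-1 (- h^-1) D1 (D2 _); rewrite gerBl => /(_ (ltW h0)).
  apply: derives_on_ext => [t|t _]; rewrite /curl_field /time_quotient addr0; ring.
- move=> f d q t p tT Op Oq dq.
  have t1 : 0 <= t + h <= T by lra.
  have t2 : 0 <= t <= T by lra.
  by rewrite /time_quotient !(field_pec H _ Op Oq dq)// subrr mul0r.
Qed.
End MaxwellFields.

Section MaxwellSolution.
Context {R : realType}.
Variables (T eps mu : R) (e h : R -> vec3 R -> vec3 R).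
Hypotheses (T_gt0 : 0 < T) (eps_gt0 : 0 < eps) (mu_gt0 : 0 < mu)
    (maxwell_eh : maxwell T eps mu e h)
    (pec_eh : pec T e h)
    (reg_e : CmCk T 0 4 e /\ CmCk T 1 2 e)
    (reg_h : CmCk T 0 4 h /\ CmCk T 1 2 h).

Definition kappa (f : bool) : R := if f then mu^-1 else eps^-1.

Definition solution : field (R := R) :=
  fun f d w t p => pr d (partials w ((if f then h else e) t) p).

Lemma pec_solution f d q t p : 0 < t <= T -> Omega p ->
    pr q p = 0 \/ pr q p = 1 -> (d == q) = f -> solution f d [::] t p = 0.
Proof.
move=> tT Op Hq dq.
have [n [nq Fn]] : exists n : vec3 R, (n = ax q \/ n = - ax q) /\ on_face n p.
  case: Hq => Hq; [exists (- ax q)|exists (ax q)]; split; auto; split=> //;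
  case: q Hq {dq} => /= Hq; tauto.
have [] := pec_eh tT Fn; rewrite /solution.
case: f dq; case: d; case: q nq {Hq} => //= -[] -> _;
 case: (e t p) => [[? ?] ?]; case: (h t p) => [[? ?] ?];
 rewrite /cross3 /dot3 /ax /unit_x /unit_y /unit_z /pr /cx /cy /cz /= ?oppr0 =>
   -[A1 A2 A3] A4; lra.
Qed.

(** The boundary condition is imposed at positive times only. *)
Lemma pec_initial k d u p : time_continuous T k u -> Omega p ->
  (forall t, 0 < t <= T -> pr d (u t p) = 0) -> pr d (u 0 p) = 0.
Proof.
move=> [_ Nu] Op H; apply/eqP; rewrite -normr_le0; apply/ler_addgt0Pr => r r0.
have T0 : (0 : R) <= 0 <= T by rewrite lexx ltW.
have := Nu 0 T0 r r0; rewrite near_withinE => -[a /= a0 A].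
set s := Num.min (a / 2) T.
have s0 : 0 < s by rewrite lt_min divr_gt0.
have sT : s <= T by rewrite ge_min lexx orbT.
have sa : s < a by rewrite gt_min; apply/orP; left; lra.
have := A s; rewrite /= sub0r normrN gtr0_norm// in_itv /= => /(_ sa) {}A.
have : Ck_norm_le k (fun p => u s p - u 0 p) r by apply: A; rewrite (ltW s0).
have -> : pr d (u 0 p) = - pr d (u s p - u 0 p).
  have -> : pr d (u s p - u 0 p) = pr d (u s p) - pr d (u 0 p) by case: (d).
  by rewrite (H s) ?s0 // sub0r opprK.
rewrite add0r normrN => B; apply: le_trans (norm_pr _ _) _.
by case: (k) B => [|l] [/(_ p Op)].
Qed.

Lemma partial_tower_curl (a b : dir) (k : R) (g : vec3 R -> vec3 R) : Ck 4 g ->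
  partial_tower 2 (fun w p =>
    k * (pr a (partials (rcons w b) g p) - pr b (partials (rcons w a) g p))).
Proof.
move=> Cg w d sw.
have A c a' : has_partial d (fun p => pr c (partials (rcons w a') g p))
                    (fun p => pr c (partials (rcons (d :: w) a') g p)).
  by apply: (Ck_partial_tower c Cg (w := rcons w a')); rewrite size_rcons ltnS;
    exact: leq_trans sw _.
have := has_partial_lincomb k (- k) (A a b) (A b a).
have E (x y : vec3 R -> R) : (fun p => k * x p + - k * y p) =
    (fun p => k * (x p - y p)) by apply/funext => p; ring.
by rewrite !E.
Qed.

Lemma solution_field : exists M, maxwell_field kappa 4 T M solution.
Proof.
have [[TCe _] [_ [ve [Te [[Cve _] _]]]]] := reg_e.
have [[TCh _] [_ [vh [Th [[Cvh _] _]]]]] := reg_h.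
have [Be HBe] := time_bounded TCe.
have [Bh HBh] := time_bounded TCh.
have C4 f t : 0 <= t <= T -> Ck 4 ((if f then h else e) t).
  by case: f; [apply: TCh.1|apply: TCe.1].
exists (Num.max Be Bh); split.
- move=> f d w a t tT sw; exact: (Ck_partial_tower d (C4 f t tT)).
- move=> f d w t p tT sw Op; rewrite le_max; apply/orP.
  by case: f; [right; apply: HBh|left; apply: HBe].
- move=> f d w p sw Op.
  set u := if f then h else e; set v := if f then vh else ve.
  have Cu t : 0 <= t <= T -> Ck 2 (u t) by move=> /(C4 f); apply: Ck_le.
  have Cv t : 0 <= t <= T -> Ck 2 (v t) by rewrite /v; case: (f); [exact: Cvh|exact: Cve].
  have Tuv : time_derivative T 2 u v by rewrite /u /v; case: (f).
  apply: derives_on_ext (time_derivative_derives_on d Cu Cv Tuv sw Op) => // t tT.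
  have tT' : 0 <= t <= T by lra.
  rewrite /curl_field.
  (* Both sides are towers of derivatives, so it suffices to compare them at the
     bottom, where they are the Maxwell equations. *)
  apply: (partial_tower_uniq (Ck_partial_tower d (Cv t tT'))
    (partial_tower_curl (dirB f d) (dirA f d) (kappa f) (C4 (~~ f) t tT'))) => // q Oq.
  have t0T : 0 < t <= T by lra.
  have := maxwell_eh t0T Oq.
  rewrite /= {Cu Cv C4 HBe HBh}; rewrite /v /kappa; case: (f).
  + move=> [_]; rewrite (time_derivative_derive_in Th tT Oq) /curl.
    case: (vh t q) => [[x y] z] [Ex Ey Ez].
    apply: (mulfI (lt0r_neq0 mu_gt0)); rewrite mulrA divff ?gt_eqF// mul1r.
    move: Ex Ey Ez; rewrite /pr /ax /cx /cy /cz /GRing.scale /=.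
    by case: d => /= Ex Ey Ez; rewrite ?Ex ?Ey ?Ez opprB.
  + move=> [+ _]; rewrite (time_derivative_derive_in Te tT Oq) /curl.
    case: (ve t q) => [[x y] z] [Ex Ey Ez].
    apply: (mulfI (lt0r_neq0 eps_gt0)); rewrite mulrA divff ?gt_eqF// mul1r.
    move: Ex Ey Ez; rewrite /pr /ax /cx /cy /cz /GRing.scale /=.
    by case: d => /= Ex Ey Ez; rewrite ?Ex ?Ey ?Ez.
- move=> f d q t p tT Op Hq dq.
  have [t0|t0] := eqVneq t 0; last first.
    by apply: (pec_solution (q := q)) => //; rewrite lt_neqAle eq_sym t0.
  have P s : 0 < s <= T -> solution f d [::] s p = 0.
    by move=> sT; apply: (pec_solution (q := q)).
  rewrite t0 {dq}; case: f P => P.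
    exact: (pec_initial TCh Op P).
  exact: (pec_initial TCe Op P).
Qed.
End MaxwellSolution.

(** * The one-step recurrence and its residual *)

Section Scheme.
Context {R : realType}.
Variables (kap : bool -> R) (M : vec3 nat) (dt : R).

Definition state : Type := bool -> dir -> vec3 nat -> R.
Implicit Types (v : state) (F G : vec3 nat -> R) (p : vec3 nat).

Definition up d p := upd d p (pr d p).+1.
Definition dn d p := upd d p (pr d p).-1.
Definition mesh d : R := pr d (step M).
Definition delta d F p : R := (F (up d p) - F (dn d p)) / mesh d.

Definition curlA v : state := fun f d p => kap f * delta (dirA f d) (v (~~ f) (dirB f d)) p.
Definition curlB v : state := fun f d p => - (kap f * delta (dirB f d) (v (~~ f) (dirA f d)) p).

(** The points at which the scheme imposes an equation. *)
Definition inner f d p : bool :=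
  f || [&& 0 < pr (nx d) p < (pr (nx d) M).*2 &
           0 < pr (pv d) p < (pr (pv d) M).*2]%N.

(** Doubled indices are odd along the axes with half-integer indices: only [d] for
    the electric component [d], the two others for the magnetic one. *)
Definition on_grid f d p : Prop :=
  forall q, (pr q p <= (pr q M).*2)%N /\ odd (pr q p) = (q == d) (+) f.

(** The half-step value, obtained by eliminating it from the two stages. Points
    that are not [inner] lie on a face where the electric component is
    tangential, and there the half-step value vanishes. *)
Definition intermediate v0 v1 : state := fun f d p =>
  if inner f d p then (v0 f d p + v1 f d p) / 2 - dt / 4 * (curlB v1 f d p - curlB v0 f d p)
  else 0.

(** The sum of the defects of the two stages; by the choice of the intermediate
    value the two defects are equal. *)
Definition residual v0 v1 : state := fun f d p =>
  (v1 f d p - v0 f d p) / dt - curlA (intermediate v0 v1) f d p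
   - (curlB v0 f d p + curlB v1 f d p) / 2.

Definition lincomb (a : R) v (b : R) w : state := fun f d p => a * v f d p + b * w f d p.

Lemma delta_lin d (a b : R) F G p :
  delta d (fun p => a * F p + b * G p) p = a * delta d F p + b * delta d G p.
Proof. by rewrite /delta; ring. Qed.

Lemma curlA_lin a b v w f d p :
  curlA (lincomb a v b w) f d p = a * curlA v f d p + b * curlA w f d p.
Proof. by rewrite /curlA delta_lin; ring. Qed.

Lemma curlB_lin a b v w f d p :
  curlB (lincomb a v b w) f d p = a * curlB v f d p + b * curlB w f d p.
Proof. by rewrite /curlB delta_lin; ring. Qed.

Lemma intermediate_lin a b v0 v1 w0 w1 :
  intermediate (lincomb a v0 b w0) (lincomb a v1 b w1) = lincomb a (intermediate v0 v1) b
    (intermediate w0 w1).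
Proof.
apply/funext => f; apply/funext => d; apply/funext => p.
rewrite [RHS]/lincomb /intermediate; case: ifP => _; last by rewrite !mulr0 addr0.
by rewrite !curlB_lin /lincomb; ring.
Qed.

Lemma residual_lin a b v0 v1 w0 w1 f d p :
  residual (lincomb a v0 b w0) (lincomb a v1 b w1) f d p = a * residual v0 v1 f d p + b *
    residual w0 w1 f d p.
Proof. by rewrite /residual intermediate_lin curlA_lin !curlB_lin /lincomb; ring. Qed.

End Scheme.

Section Truncation.
Context {R : realType}.
Variables (kap : bool -> R) (M : vec3 nat) (dt T B : R) (U : field (R := R)).
Hypothesis kap_gt0 : forall f, 0 < kap f.
Hypothesis M_gt1 : forall q, (1 < pr q M)%N.
Hypothesis dt_gt0 : 0 < dt.
Hypothesis HU : maxwell_field kap 3 T B U.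
Implicit Types (p : vec3 nat).

Local Notation mesh := (@mesh R M).
Local Notation K := (kap_sum kap).

Definition grid_node p : vec3 R := node M (cx p) (cy p) (cz p).
Definition sample (t : R) : state (R := R) := fun f d p => U f d [::] t (grid_node p).

Lemma mesh_gt0 d : 0 < mesh d.
Proof.
have : 0 < (pr d M)%:R^-1 :> R by rewrite invr_gt0 ltr0n; apply: ltn_trans (M_gt1 d).
by rewrite /mesh /step; case: (d).
Qed.

Lemma pr_grid_node d p : pr d (grid_node p) = (pr d p)%:R / 2 * mesh d.
Proof. by case: d. Qed.

Lemma grid_node_up d p :
  grid_node (up d p) = upd d (grid_node p) (pr d (grid_node p) + mesh d / 2).
Proof.
have E : pr d (grid_node p) + mesh d / 2 = (pr d p).+1%:R / 2 * mesh d.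
  by rewrite pr_grid_node -natr1; field.
by rewrite E; case: p {E} => -[x y] z; case: d.
Qed.

Lemma grid_node_dn d p : (0 < pr d p)%N ->
  grid_node (dn d p) = upd d (grid_node p) (pr d (grid_node p) - mesh d / 2).
Proof.
move=> p0; have E : pr d (grid_node p) - mesh d / 2 = (pr d p).-1%:R / 2 * mesh d.
  by rewrite pr_grid_node -{1}(prednK p0) -natr1; field.
by rewrite E; case: p {E p0} => -[x y] z; case: d.
Qed.

Lemma Omega_grid_node p : (forall q, (pr q p <= (pr q M).*2)%N) -> Omega (grid_node p).
Proof.
move=> H; apply/OmegaP => q; rewrite pr_grid_node.
have M0 : 0 < (pr q M)%:R :> R by rewrite ltr0n; apply: ltn_trans (M_gt1 q).
have -> : mesh q = (pr q M)%:R^-1 by rewrite /mesh; case: (q).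
apply/andP; split; first by rewrite mulr_ge0 ?invr_ge0 ?divr_ge0// ltW.
rewrite ler_pdivrMr// mul1r ler_pdivrMr// mulr_natr -mulrnA muln2 ler_nat.
exact: H.
Qed.

Lemma pr_up c d p : pr c (up d p) = if c == d then (pr d p).+1 else pr c p.
Proof. exact: pr_upd. Qed.

Lemma pr_dn c d p : pr c (dn d p) = if c == d then (pr d p).-1 else pr c p.
Proof. exact: pr_upd. Qed.

Lemma delta_central d (phi phi1 phi2 phi3 : vec3 R -> R) p (L : R) :
  has_partial d phi phi1 -> has_partial d phi1 phi2 -> has_partial d phi2 phi3 ->
  (forall x, Omega x -> `|phi3 x| <= L) ->
  (forall q, (pr q p <= (pr q M).*2)%N) -> (0 < pr d p < (pr d M).*2)%N ->
  `|delta M d (fun q => phi (grid_node q)) p - phi1 (grid_node p)| <= L / 4 * mesh d ^+ 2.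
Proof.
move=> H1 H2 H3 HL Hp /andP[p0 p1].
have Op := Omega_grid_node Hp; have h0 := mesh_gt0 d.
have Ou : Omega (grid_node (up d p)).
  by apply: Omega_grid_node => q; rewrite pr_up; case: eqP => [->|_].
have Od : Omega (grid_node (dn d p)).
  apply: Omega_grid_node => q; rewrite pr_dn; case: eqP => [->|_] //.
  exact: leq_trans (leq_pred _) _.
have := central_difference (has_partial_derives_on H1 Op) (has_partial_derives_on H2 Op)
  (has_partial_derives_on H3 Op)
  (x := pr d (grid_node p)) (h := mesh d / 2) (M := L).
rewrite /delta grid_node_up grid_node_dn//.
have -> : 2 * (mesh d / 2) = mesh d by field.
have upd_id : upd d (grid_node p) (pr d (grid_node p)) = grid_node p by case: (d);
  case: (grid_node p) => -[].
have -> : L * (mesh d / 2) ^+ 2 = L / 4 * mesh d ^+ 2 by field.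
rewrite upd_id; apply.
- by move=> z z01; apply: HL; apply: Omega_upd => //; lra.
- by lra.
- by have /OmegaP/(_ d) := Od; rewrite grid_node_dn// pr_upd eqxx => /andP[].
- by have /OmegaP/(_ d) := Ou; rewrite grid_node_up pr_upd eqxx => /andP[].
Qed.

Lemma delta_delta a b (phi phi1 phi2 : vec3 R -> R) p (L : R) :
  a != b -> has_partial a phi phi1 -> has_partial b phi1 phi2 ->
  (forall x, Omega x -> `|phi2 x| <= L) ->
  (forall q, (pr q p <= (pr q M).*2)%N) ->
  (0 < pr a p < (pr a M).*2)%N -> (0 < pr b p < (pr b M).*2)%N ->
  `|delta M a (delta M b (fun q => phi (grid_node q))) p| <= L.
Proof.
move=> ab H1 H2 HL Hp /andP[a0 a1] /andP[b0 b1].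
have ha := mesh_gt0 a; have hb := mesh_gt0 b.
have ba : b != a by rewrite eq_sym.
have Ou : Omega (grid_node (up b p)).
  by apply: Omega_grid_node => q; rewrite pr_up; case: eqP => [->|_].
have Od : Omega (grid_node (dn b p)).
  apply: Omega_grid_node => q; rewrite pr_dn; case: eqP => [->|_] //.
  exact: leq_trans (leq_pred _) _.
have Oa : Omega (grid_node (up a p)).
  by apply: Omega_grid_node => q; rewrite pr_up; case: eqP => [->|_].
have Oa' : Omega (grid_node (dn a p)).
  apply: Omega_grid_node => q; rewrite pr_dn; case: eqP => [->|_] //.
  exact: leq_trans (leq_pred _) _.
have := mean_value_le (derives_on_lincomb 1 (-1) (has_partial_derives_on H1 Ou)
  (has_partial_derives_on H1 Od)).
set x := pr a (grid_node p) - mesh a / 2; set y := pr a (grid_node p) + mesh a / 2.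
move=> /(_ x y (L * mesh b)).
have x01 : 0 <= x <= 1.
  by have /OmegaP/(_ a) := Oa'; rewrite grid_node_dn// pr_upd eqxx.
have y01 : 0 <= y <= 1.
  by have /OmegaP/(_ a) := Oa; rewrite grid_node_up pr_upd eqxx.
have xy : y - x = mesh a by rewrite /x /y; field.
rewrite xy (gtr0_norm ha) => /(_ x01 y01) H.
have C1 : up b (up a p) = up a (up b p) by case: (a) (b) ab => -[].
have C2 : dn b (up a p) = up a (dn b p) by case: (a) (b) ab => -[].
have C3 : up b (dn a p) = dn a (up b p) by case: (a) (b) ab => -[].
have C4 : dn b (dn a p) = dn a (dn b p) by case: (a) (b) ab => -[].
have Pu : pr a (up b p) = pr a p by rewrite pr_up (negPf ab).
have Pd : pr a (dn b p) = pr a p by rewrite pr_dn (negPf ab).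
have uE : grid_node (up a (up b p)) = upd a (grid_node (up b p)) y
  by rewrite grid_node_up pr_grid_node Pu -pr_grid_node.
have dE : grid_node (up a (dn b p)) = upd a (grid_node (dn b p)) y
  by rewrite grid_node_up pr_grid_node Pd -pr_grid_node.
have uE' : grid_node (dn a (up b p)) = upd a (grid_node (up b p)) x
  by rewrite grid_node_dn ?pr_grid_node Pu// -pr_grid_node.
have dE' : grid_node (dn a (dn b p)) = upd a (grid_node (dn b p)) x
  by rewrite grid_node_dn ?pr_grid_node Pd// -pr_grid_node.
rewrite /delta C1 C2 C3 C4 uE dE uE' dE'.
have hab : 0 < mesh b * mesh a by rewrite mulr_gt0.
rewrite -(ler_pM2r hab) -{1}(gtr0_norm hab) -normrM (mulrA L).
move: H; rewrite !mul1r !mulN1r => H.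
apply: le_trans (H _); last first.
  move=> z z01 _; rewrite mul1r mulN1r.
  have z01' : 0 <= z <= 1 by lra.
  have -> : mesh b = `|pr b (upd a (grid_node (up b p)) z) - pr b (upd a (grid_node (dn b
    p)) z)|.
    rewrite !pr_upd (negPf ba) grid_node_up grid_node_dn// !pr_upd eqxx.
    by rewrite (_ : _ - _ = mesh b) ?gtr0_norm//; field.
  apply: (has_partial_mean_value_le H2 HL) => [||c cb]; [exact: Omega_upd|exact: Omega_upd|].
  by rewrite !pr_upd grid_node_up grid_node_dn// !pr_upd (negPf cb).
rewrite le_eqVlt; apply/orP; left; apply/eqP; congr (`|_|).
by field; rewrite !gt_eqF.
Qed.

Lemma curl_field_derives_on (V V' : field (R := R)) f d w (p : vec3 R) :
  (forall g c a, derives_on 0 T (fun t => V g c (rcons w a) t p)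
                         (fun t => V' g c (rcons w a) t p)) ->
  derives_on 0 T (fun t => curl_field kap V f d w t p) (fun t => curl_field kap V' f d w t p).
Proof.
move=> H; have := derives_on_lincomb (kap f) (- kap f)
  (H (~~ f) (dirB f d) (dirA f d)) (H (~~ f) (dirA f d) (dirB f d)).
by apply: derives_on_ext => [t|t _]; rewrite /curl_field; ring.
Qed.

Lemma curl_field_le (V : field (R := R)) f d w t (p : vec3 R) (L : R) : 0 <= L ->
  (forall g c a, `|V g c (rcons w a) t p| <= L) ->
  `|curl_field kap V f d w t p| <= 2 * K * L.
Proof.
move=> L0 H; rewrite /curl_field normrM gtr0_norm// (mulrC 2) -mulrA.
apply: ler_pM => //; [exact: ltW|exact: kap_le|].
apply: le_trans (ler_normB _ _) _.
by have := H (~~ f) (dirB f d) (dirA f d); have := H (~~ f) (dirA f d) (dirB f d); lra.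
Qed.

Lemma delta_derives_on d (F F' : vec3 nat -> R -> R) p :
  derives_on 0 T (F (up d p)) (F' (up d p)) -> derives_on 0 T (F (dn d p)) (F' (dn d p)) ->
  derives_on 0 T (fun t => delta M d (F ^~ t) p) (fun t => delta M d (F' ^~ t) p).
Proof.
move=> H1 H2; have := derives_on_lincomb (mesh d)^-1 (- (mesh d)^-1) H1 H2.
by apply: derives_on_ext => [t|t _]; rewrite /delta; ring.
Qed.

Lemma kap_sum_gt0 : 0 < K. Proof. by rewrite /kap_sum addr_gt0. Qed.

Lemma field_bound_ge0 t : 0 <= t <= T -> 0 <= B.
Proof.
move=> tT; have O0 : Omega (0, 0, 0 : R) by apply/OmegaP; case; rewrite /= lexx ler01.
exact: le_trans (field_bound HU false X (w := [::]) tT isT O0).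
Qed.

Lemma curl_field3_le f d t (p : vec3 R) : 0 <= t <= T -> Omega p ->
  `|curl_field kap (curl_field kap (curl_field kap U)) f d [::] t p| <= 8 * K ^+ 3 * B.
Proof.
move=> tT Op; have k0 := kap_sum_gt0; have b0 := field_bound_ge0 tT.
have -> : 8 * K ^+ 3 * B = 2 * K * (2 * K * (2 * K * B)) by ring.
apply: curl_field_le; first by rewrite !mulr_ge0// ltW.
move=> g c a; apply: curl_field_le => [|g' c' a']; first by rewrite !mulr_ge0// ltW.
apply: curl_field_le => // g2 c2 a2.
exact: (field_bound HU).
Qed.

Lemma trapezoid_error f d t (p : vec3 R) : Omega p -> 0 <= t -> t + dt <= T ->
  `|(U f d [::] (t + dt) p - U f d [::] t p) / dt
    - (curl_field kap U f d [::] t p + curl_field kap U f d [::] (t + dt) p) / 2|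
  <= 16 * K ^+ 3 * B * dt ^+ 2.
Proof.
move=> Op t0 tT.
have D1 := field_time HU f d (w := [::]) isT Op.
have D2 : derives_on 0 T (fun t => curl_field kap U f d [::] t p)
                  (fun t => curl_field kap (curl_field kap U) f d [::] t p).
  by apply: curl_field_derives_on => g c a; exact: (field_time HU).
have D3 : derives_on 0 T (fun t => curl_field kap (curl_field kap U) f d [::] t p)
    (fun t => curl_field kap (curl_field kap (curl_field kap U)) f d [::] t p).
  apply: curl_field_derives_on => g c a; apply: curl_field_derives_on => g' c' a';
    exact: (field_time HU).
have -> : 16 * K ^+ 3 * B * dt ^+ 2 = 2 * (8 * K ^+ 3 * B) * dt ^+ 2 by ring.
apply: (trapezoid D1 D2 D3) => // z zT; apply: curl_field3_le => //; lra.
Qed.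

Lemma space_error f d a t p : 0 <= t <= T ->
  (forall q, (pr q p <= (pr q M).*2)%N) -> (0 < pr a p < (pr a M).*2)%N ->
  `|delta M a (sample t f d) p - U f d [:: a] t (grid_node p)| <= B / 4 * mesh a ^+ 2.
Proof.
move=> tT Hp Ha.
apply: (@delta_central a _ _ (U f d [:: a; a] t) (U f d [:: a; a; a] t)) => //.
- exact: (field_space HU).
- exact: (field_space HU).
- exact: (field_space HU).
- by move=> x Ox; exact: (field_bound HU).
Qed.

(** This is the term that the splitting adds to the Crank-Nicolson residual; the
    mixed second difference of [U] is Lipschitz in time since the time derivative
    of [U] is a curl, with bounded second space derivatives. *)
Lemma splitting_error f d a b t p : a != b -> 0 <= t -> t + dt <= T ->
  (forall q, (pr q p <= (pr q M).*2)%N) ->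
  (0 < pr a p < (pr a M).*2)%N -> (0 < pr b p < (pr b M).*2)%N ->
  `|delta M a (delta M b (sample (t + dt) f d)) p - delta M a (delta M b (sample t f d)) p|
     <= 2 * K * B * dt.
Proof.
move=> ab t0 tT Hp Ha Hb; have [a0 a1] := andP Ha; have [b0 b1] := andP Hb.
have ba : b != a by rewrite eq_sym.
have Hu c q : (forall x, (pr x q <= (pr x M).*2)%N) -> (pr c q < (pr c M).*2)%N ->
    forall x, (pr x (up c q) <= (pr x M).*2)%N.
  by move=> Hq Hc x; rewrite pr_up; case: eqP => [->|_].
have Hd c q : (forall x, (pr x q <= (pr x M).*2)%N) ->
    forall x, (pr x (dn c q) <= (pr x M).*2)%N.
  move=> Hq x; rewrite pr_dn; case: eqP => [->|_] //.
  exact: leq_trans (leq_pred _) _.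
have Db q : (forall x, (pr x q <= (pr x M).*2)%N) -> (pr b q < (pr b M).*2)%N ->
    derives_on 0 T (fun s => delta M b (sample s f d) q)
            (fun s => delta M b (fun q => curl_field kap U f d [::] s (grid_node q)) q).
  move=> Hq Hc; apply: (@delta_derives_on b (fun q s => U f d [::] s (grid_node q))
    (fun q s => curl_field kap U f d [::] s (grid_node q))).
  - by apply: (field_time HU) => //; apply: Omega_grid_node; apply: Hu.
  - by apply: (field_time HU) => //; apply: Omega_grid_node; apply: Hd.
have Dab : derives_on 0 T (fun s => delta M a (delta M b (sample s f d)) p)
   (fun s => delta M a (delta M b (fun q => curl_field kap U f d [::] s (grid_node q))) p).
  apply: (@delta_derives_on a (fun q s => delta M b (sample s f d) q)
    (fun q s => delta M b (fun q => curl_field kap U f d [::] s (grid_node q)) q)).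
  - by apply: Db; [exact: Hu|rewrite pr_up (negPf ba)].
  - by apply: Db; [exact: Hd|rewrite pr_dn (negPf ba)].
have d0 := dt_gt0; have t1 : 0 <= t <= T by lra.
have t2 : 0 <= t + dt <= T by lra.
have := mean_value_le Dab t1 t2 (M := 2 * K * B).
have -> : t + dt - t = dt by ring.
rewrite (gtr0_norm dt_gt0); apply => z zT _.
have z1 : 0 <= z <= T by lra.
apply: (@delta_delta a b _ _ (curl_field kap U f d [:: b; a] z)) => //.
- exact: (has_partial_curl _ _ _ HU).
- exact: (has_partial_curl _ _ _ HU).
- by move=> x Ox; apply: (curl_field_bound kap_gt0 _ _ HU).
Qed.

Lemma dirA_dirB f d : dirA (~~ f) (dirB f d) = dirA f d. Proof. by case: f; case: d. Qed.
Lemma dirB_dirB f d : dirB (~~ f) (dirB f d) = d. Proof. by case: f; case: d. Qed.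
Lemma dirA_neq f d : dirA f d != d. Proof. by case: f; case: d. Qed.
Lemma dirB_neq f d : dirB f d != d. Proof. by case: f; case: d. Qed.
Lemma dirA_neq_dirB f d : dirA f d != dirB f d. Proof. by case: f; case: d. Qed.

Definition on_bnd q p : Prop := pr q p = 0%N \/ pr q p = (pr q M).*2.

Lemma sample_face f d q t p : 0 <= t <= T ->
  (forall x, (pr x p <= (pr x M).*2)%N) -> on_bnd q p -> (d == q) = f ->
  sample t f d p = 0.
Proof.
move=> tT Hp Hq dq; apply: (field_pec HU tT (Omega_grid_node Hp) _ dq).
rewrite pr_grid_node; case: Hq => ->; [left; by rewrite !mul0r|right].
have : (pr q M)%:R != 0 :> R by rewrite pnatr_eq0 -lt0n; apply: ltn_trans (M_gt1 q).
have -> : mesh q = (pr q M)%:R^-1 by rewrite /mesh; case: (q).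
by rewrite -muln2 natrM => M0; field.
Qed.

Lemma up_le c p : (forall x, (pr x p <= (pr x M).*2)%N) -> (pr c p < (pr c M).*2)%N ->
  forall x, (pr x (up c p) <= (pr x M).*2)%N.
Proof. by move=> Hq Hc x; rewrite pr_up; case: eqP => [->|_]. Qed.

Lemma dn_le c p : (forall x, (pr x p <= (pr x M).*2)%N) ->
  forall x, (pr x (dn c p) <= (pr x M).*2)%N.
Proof.
move=> Hq x; rewrite pr_dn; case: eqP => [->|_] //.
exact: leq_trans (leq_pred _) _.
Qed.

Lemma delta_pec f d a q t p : 0 <= t <= T ->
  (forall x, (pr x p <= (pr x M).*2)%N) -> on_bnd q p -> (d == q) = f ->
  a != q -> (pr a p < (pr a M).*2)%N -> delta M a (sample t f d) p = 0.
Proof.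
move=> tT Hp Hq dq aq Ha; have qa : (q == a) = false by rewrite eq_sym; exact: negPf.
rewrite /delta (@sample_face f d q t (up a p))//; last first.
- by rewrite /on_bnd pr_up qa.
- exact: up_le.
rewrite (@sample_face f d q t (dn a p))//; last first.
- by rewrite /on_bnd pr_dn qa.
- exact: dn_le.
by rewrite subrr mul0r.
Qed.

(** For [f = true] the point may lie on a face orthogonal to [dirA f d]. There the
    tangential components of the electric field vanish, and so do the tangential
    differences of the normal component of the magnetic field; hence extending
    the intermediate value by zero agrees with its formula. *)
Lemma intermediate_formula f d t p : 0 <= t -> t + dt <= T ->
  (forall x, (pr x p <= (pr x M).*2)%N) ->
  (forall x, x != dirA f d -> (0 < pr x p < (pr x M).*2)%N) ->
  intermediate kap M dt (sample t) (sample (t + dt)) (~~ f) (dirB f d) p =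
   (sample t (~~ f) (dirB f d) p + sample (t + dt) (~~ f) (dirB f d) p) / 2
   + dt / 4 * kap (~~ f) *
     (delta M d (sample (t + dt) f (dirA f d)) p - delta M d (sample t f (dirA f d)) p).
Proof.
move=> t0 tT Hp Hx; have d0 := dt_gt0.
have t1 : 0 <= t <= T by lra.
have t2 : 0 <= t + dt <= T by lra.
rewrite /intermediate; case: ifP => [_|].
  by rewrite /curlB dirB_dirB dirA_dirB negbK; ring.
case: f Hx => //= Hx Hin.
have Hd : (0 < pr d p < (pr d M).*2)%N by apply: Hx; rewrite eq_sym; exact: (dirA_neq true).
have [d1 d2] := andP Hd.
have bnd : on_bnd (pv d) p.
  move: Hin; rewrite /inner /=.
  have -> : nx (nx d) = pv d by case: (d).
  have -> : pv (nx d) = d by case: (d).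
  rewrite Hd andbT => /negbT; rewrite negb_and -!leqNgt leqn0 => /orP[/eqP|H]; [by left|right].
  by apply/eqP; rewrite eqn_leq Hp.
have E0 s : 0 <= s <= T -> sample s false (nx d) p = 0.
  by move=> sT; apply: (sample_face sT Hp bnd); case: (d).
have D0 s : 0 <= s <= T -> delta M d (sample s true (pv d)) p = 0.
  by move=> sT; apply: (delta_pec sT Hp bnd) => //; case: (d).
by rewrite !E0// !D0//; ring.
Qed.

(** On the faces orthogonal to [d] the magnetic component [d] is normal and the
    electric components next to it are tangential: every term vanishes. *)
Lemma truncation_face d t p : 0 <= t -> t + dt <= T -> on_grid M true d p ->
  on_bnd d p -> residual kap M dt (sample t) (sample (t + dt)) true d p = 0.
Proof.
move=> t0 tT Hp bnd; have d0 := dt_gt0.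
have t1 : 0 <= t <= T by lra.
have t2 : 0 <= t + dt <= T by lra.
have Hle x : (pr x p <= (pr x M).*2)%N by have [] := Hp x.
have Hodd x : x != d -> (0 < pr x p < (pr x M).*2)%N.
  move=> xd; have [px] := Hp x; rewrite (negPf xd) /= => ox.
  rewrite odd_gt0// ltn_neqAle px andbT; apply/eqP => E.
  by rewrite E odd_double in ox.
have S0 q : pr d q = pr d p -> intermediate kap M dt (sample t) (sample (t + dt)) false (nx
  d) q = 0.
  move=> E; rewrite /intermediate; case: ifP => //.
  rewrite /inner /= (_ : pv (nx d) = d); last by case: (d).
  by rewrite E; case: bnd => ->; rewrite ?ltnn !andbF.
rewrite /residual /curlA /curlB !(sample_face _ Hle bnd)//; try by rewrite eqxx.
rewrite /= {1}/delta !S0; last 2 first.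
- by rewrite pr_dn; case: (d).
- by rewrite pr_up; case: (d).
rewrite !(delta_pec _ Hle bnd (f := false))//.
- by ring.
- by case: (d).
- by case: (d).
- by have /andP[] := Hodd (nx d) (dirB_neq true d).
- by case: (d).
- by case: (d).
- by have /andP[] := Hodd (nx d) (dirB_neq true d).
Qed.

Lemma mesh_sqr_le f d : mesh (dirA f d) ^+ 2 + mesh (dirB f d) ^+ 2 <=
  mesh X ^+ 2 + mesh Y ^+ 2 + mesh Z ^+ 2.
Proof.
have := sqr_ge0 (mesh X); have := sqr_ge0 (mesh Y); have := sqr_ge0 (mesh Z).
by case: f; case: d => /=; lra.
Qed.

(** The residual is the trapezoidal error, four errors of central differences,
    and the splitting error. *)
Lemma truncation_interior f d t p : 0 <= t -> t + dt <= T ->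
  (forall x, (pr x p <= (pr x M).*2)%N) ->
  (forall x, (0 < pr x p < (pr x M).*2)%N) ->
  `|residual kap M dt (sample t) (sample (t + dt)) f d p| <=
    (20 * K ^+ 3 + K) * B * (dt ^+ 2 + mesh X ^+ 2 + mesh Y ^+ 2 + mesh Z ^+ 2).
Proof.
move=> t0 tT Hle Hin; have d0 := dt_gt0; have k0 := kap_sum_gt0.
have t1 : 0 <= t <= T by lra.
have t2 : 0 <= t + dt <= T by lra.
have b0 := field_bound_ge0 t1.
have Op := Omega_grid_node Hle.
set r := dirA f d; set s := dirB f d.
(* The curls of the exact solution at both times are added and subtracted. *)
have -> : residual kap M dt (sample t) (sample (t + dt)) f d p =
  ((sample (t + dt) f d p - sample t f d p) / dt
    - (curl_field kap U f d [::] t (grid_node p) + curl_field kap U f d [::] (t + dt)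
      (grid_node p)) / 2)
  - kap f / 2 * ((delta M r (sample t (~~ f) s) p - U (~~ f) s [:: r] t (grid_node p))
      + (delta M r (sample (t + dt) (~~ f) s) p - U (~~ f) s [:: r] (t + dt) (grid_node p)))
  + kap f / 2 * ((delta M s (sample t (~~ f) r) p - U (~~ f) r [:: s] t (grid_node p))
      + (delta M s (sample (t + dt) (~~ f) r) p - U (~~ f) r [:: s] (t + dt) (grid_node p)))
  - kap f * kap (~~ f) * dt / 4 *
     (delta M r (delta M d (sample (t + dt) f r)) p - delta M r (delta M d (sample t f r)) p).
  have star_at q : (q = up r p) \/ (q = dn r p) ->
     intermediate kap M dt (sample t) (sample (t + dt)) (~~ f) s q =
     (sample t (~~ f) s q + sample (t + dt) (~~ f) s q) / 2
     + dt / 4 * kap (~~ f) *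
       (delta M d (sample (t + dt) f r) q - delta M d (sample t f r) q).
    move=> Hq; apply: intermediate_formula => //.
      case: Hq => ->; [apply: up_le => //|exact: dn_le].
      by have /andP[] := Hin r.
    by move=> x /negPf xr; case: Hq => ->; rewrite ?pr_up ?pr_dn xr.
  rewrite /residual /curlA /curlB {1}/delta -/r -/s !star_at; [|by right|by left].
  rewrite /curl_field /= -/r -/s.
  have hr : mesh r != 0 by rewrite gt_eqF// mesh_gt0.
  have delE F : delta M r F p = (F (up r p) - F (dn r p)) / mesh r by [].
  by rewrite !delE; field; rewrite hr gt_eqF.
have A1 := trapezoid_error f d Op t0 tT.
have A2 := space_error (~~ f) s t1 Hle (Hin r).
have A3 := space_error (~~ f) s t2 Hle (Hin r).
have A4 := space_error (~~ f) r t1 Hle (Hin s).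
have A5 := space_error (~~ f) r t2 Hle (Hin s).
have A6 := splitting_error f r (dirA_neq f d) t0 tT Hle (Hin r) (Hin d).
have kf := kap_gt0 f; have kK := kap_le kap_gt0 f.
have kf' := kap_gt0 (~~ f); have kK' := kap_le kap_gt0 (~~ f).
have half (c x y L : R) : `|x| <= L -> `|y| <= L -> 0 < c -> c <= K ->
    `|c / 2 * (x + y)| <= K * L.
  move=> xL yL c0 cK; rewrite normrM gtr0_norm ?divr_gt0//.
  have := ler_normD x y => xy.
  have L0 : 0 <= L by apply: le_trans xL.
  have : c / 2 * `|x + y| <= c / 2 * (L + L).
    by rewrite ler_wpM2l ?divr_ge0 ?(ltW c0)//; lra.
  have : c * L <= K * L by rewrite ler_wpM2r.
  lra.
have C1 := half _ _ _ _ A2 A3 kf kK.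
have C2 := half _ _ _ _ A4 A5 kf kK.
have C3 (x : R) : `|x| <= 2 * K * B * dt ->
    `|kap f * kap (~~ f) * dt / 4 * x| <= K ^+ 3 * B * dt ^+ 2.
  move=> xL; rewrite normrM gtr0_norm; last by rewrite !(mulr_gt0, divr_gt0).
  have kk : kap f * kap (~~ f) <= K * K by apply: ler_pM => //; exact: ltW.
  have L0 : 0 <= 2 * K * B * dt by exact: le_trans xL.
  have : kap f * kap (~~ f) * dt / 4 * `|x| <= K * K * dt / 4 * (2 * K * B * dt).
    apply: ler_pM => //; first by rewrite !(mulr_ge0, divr_ge0)// ltW.
    by rewrite -!mulrA !(mulrA _ _ (dt / 4)) ler_wpM2r// divr_ge0// ltW.
  move/le_trans; apply.
  have -> : K * K * dt / 4 * (2 * K * B * dt) = (K ^+ 3 * B * dt ^+ 2) / 2 by field.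
  have : 0 <= K ^+ 3 * B * dt ^+ 2 by rewrite !mulr_ge0 ?exprn_ge0// ltW.
  lra.
have {}C3 := C3 _ A6.
apply: le_trans (ler_normB _ _) _; rewrite -lerBrDr.
apply: le_trans (ler_normD _ _) _; rewrite -lerBrDr.
apply: le_trans (ler_normB _ _) _; rewrite -lerBrDr.
apply: le_trans A1 _.
have Hrs : mesh r ^+ 2 + mesh s ^+ 2 <= mesh X ^+ 2 + mesh Y ^+ 2 + mesh Z ^+ 2.
  exact: mesh_sqr_le.
set S := mesh X ^+ 2 + mesh Y ^+ 2 + mesh Z ^+ 2 in Hrs *.
have S0 : 0 <= S by apply: le_trans Hrs; rewrite addr_ge0 ?sqr_ge0.
have -> : dt ^+ 2 + mesh X ^+ 2 + mesh Y ^+ 2 + mesh Z ^+ 2 = dt ^+ 2 + S by rewrite /S !addrA.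
have P0 : 0 <= K ^+ 3 * B by rewrite mulr_ge0 // exprn_ge0 // ltW.
have Q0 : 0 <= K * B by rewrite mulr_ge0 // ltW.
have D0 : 0 <= dt ^+ 2 by exact: sqr_ge0.
have := mulr_ge0 P0 S0; have := mulr_ge0 P0 D0; have := mulr_ge0 Q0 D0.
have := ler_wpM2l Q0 Hrs.
have := mulr_ge0 Q0 (sqr_ge0 (mesh r)); have := mulr_ge0 Q0 (sqr_ge0 (mesh s)).
move: C1 C2 C3.
have -> : K * (B / 4 * mesh r ^+ 2) = K * B * mesh r ^+ 2 / 4 by field.
have -> : K * (B / 4 * mesh s ^+ 2) = K * B * mesh s ^+ 2 / 4 by field.
have -> : 16 * K ^+ 3 * B * dt ^+ 2 = 16 * (K ^+ 3 * B * dt ^+ 2) by ring.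
have -> : (20 * K ^+ 3 + K) * B * (dt ^+ 2 + S) =
  20 * (K ^+ 3 * B * dt ^+ 2) + 20 * (K ^+ 3 * B * S) + K * B * dt ^+ 2 + K * B * S by ring.
rewrite mulrDr; lra.
Qed.

Lemma truncation f d t p : 0 <= t -> t + dt <= T -> on_grid M f d p -> inner M f d p ->
  `|residual kap M dt (sample t) (sample (t + dt)) f d p| <=
    (20 * K ^+ 3 + K) * B * (dt ^+ 2 + mesh X ^+ 2 + mesh Y ^+ 2 + mesh Z ^+ 2).
Proof.
move=> t0 tT Hp Hin; have d0 := dt_gt0.
have t1 : 0 <= t <= T by lra.
have Hle x : (pr x p <= (pr x M).*2)%N by have [] := Hp x.
have Hodd x : (x == d) (+) f -> (0 < pr x p < (pr x M).*2)%N.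
  move=> xd; have [px] := Hp x; rewrite xd => ox.
  rewrite odd_gt0// ltn_neqAle px andbT; apply/eqP => E.
  by rewrite E odd_double in ox.
case: f Hp Hin Hodd => Hp Hin Hodd; last first.
  apply: truncation_interior => // x; have [->|] := eqVneq x d.
    by apply: Hodd; rewrite eqxx.
  by move: Hin => /andP[H1 H2]; case: (x) (d) H1 H2 => -[].
have [bnd|nbnd] := pselect (on_bnd d p).
  rewrite truncation_face// normr0 mulr_ge0//.
    have k0 := kap_sum_gt0; apply: mulr_ge0; last exact: (field_bound_ge0 t1).
    by rewrite addr_ge0 ?mulr_ge0 ?exprn_ge0 ?(ltW k0).
  by rewrite !addr_ge0 ?sqr_ge0.
apply: truncation_interior => // x; have [->|xd] := eqVneq x d; last first.
  by apply: Hodd; rewrite (negPf xd).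
apply/andP; split; first by rewrite lt0n; apply/eqP => E; apply: nbnd; left.
by rewrite ltn_neqAle Hle andbT; apply/eqP => E; apply: nbnd; right.
Qed.
End Truncation.

(** * Sums over the staggered grids *)

Section SummationByParts.
Context {R : realType}.
Implicit Types (F G : nat -> R).

Inductive kind := Half | Int | IntB.

Definition index_range (k : kind) (n : nat) : seq nat :=
  match k with
  | Half => [seq half_idx i | i <- index_iota 0 n]
  | Int => [seq int_idx i | i <- index_iota 1 n]
  | IntB => [seq int_idx i | i <- index_iota 0 n.+1]
  end.

Lemma mem_index_range k n a : (0 < n)%N -> a \in index_range k n ->
  match k with
  | Half => odd a /\ (a < n.*2)%N
  | Int => ~~ odd a /\ (0 < a < n.*2)%N
  | IntB => ~~ odd a /\ (a <= n.*2)%N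
  end.
Proof.
move=> n0; case: k => /mapP [i]; rewrite mem_index_iota => /andP[i1 i2] ->;
  rewrite /half_idx /int_idx /= odd_double; split => //.
- by rewrite -doubleS leq_double.
- by rewrite double_gt0 i1 ltn_double.
- by rewrite leq_double -ltnS.
Qed.

(** By induction on [n] for the difference of the two sides, which telescopes to
    the boundary term at [n]. *)
Lemma summation_by_parts1 n F G : (0 < n)%N -> G 0%N = 0 -> G (n.*2) = 0 ->
  \sum_(i <- index_range Int n) (F i.+1 - F i.-1) * G i =
  - \sum_(i <- index_range Half n) F i * (G i.+1 - G i.-1).
Proof.
move=> n0 G0 Gn; rewrite !big_map; apply/eqP; rewrite -addr_eq0; apply/eqP.
suff -> : \sum_(1 <= j < n) (F (int_idx j).+1 - F (int_idx j).-1) * G (int_idx j) +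
  \sum_(0 <= j < n) F (half_idx j) * (G (half_idx j).+1 - G (half_idx j).-1) =
  F (half_idx n.-1) * G n.*2 by rewrite Gn mulr0.
elim: n n0 {Gn} => // -[_ _|n IH _].
  by rewrite big_geq// big_nat1 add0r /half_idx /= G0 subr0.
rewrite big_nat_recr //= [X in _ + X]big_nat_recr //= addrACA IH//.
rewrite /half_idx /int_idx /= !doubleS /=; ring.
Qed.

Lemma sum_IntB n F : (0 < n)%N -> F 0%N = 0 -> F (n.*2) = 0 ->
  \sum_(i <- index_range IntB n) F i = \sum_(i <- index_range Int n) F i.
Proof.
move=> n0 F0 Fn; rewrite !big_map big_nat_recr //= /int_idx Fn addr0.
by rewrite big_ltn// F0 add0r.
Qed.
End SummationByParts.

Section GridSums.
Context {R : realType}.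
Variable M : vec3 nat.
Hypothesis M_gt1 : forall q, (1 < pr q M)%N.
Implicit Types (k : dir -> kind) (F G : vec3 nat -> R) (p : vec3 nat).

Let M_gt0 q : (0 < pr q M)%N. Proof. exact: ltn_trans (M_gt1 q). Qed.

Definition in_range k p : Prop := forall q, pr q p \in index_range (k q) (pr q M).

Definition sum3 k F : R :=
  \sum_(a <- index_range (k X) (pr X M)) \sum_(b <- index_range (k Y) (pr Y M))
    \sum_(c <- index_range (k Z) (pr Z M)) F (a, b, c).

Lemma eq_sum3 k F G : (forall p, in_range k p -> F p = G p) -> sum3 k F = sum3 k G.
Proof.
move=> H; apply: eq_big_seq => a Ha; apply: eq_big_seq => b Hb.
by apply: eq_big_seq => c Hc; apply: H; case.
Qed.

Lemma le_sum3 k F G : (forall p, in_range k p -> F p <= G p) -> sum3 k F <= sum3 k G.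
Proof.
move=> H; rewrite /sum3 big_seq [leRHS]big_seq; apply: ler_sum => a Ha.
rewrite big_seq [leRHS]big_seq; apply: ler_sum => b Hb.
rewrite big_seq [leRHS]big_seq; apply: ler_sum => c Hc.
by apply: H; case.
Qed.

Lemma sum3_lin k (x y : R) F G :
  sum3 k (fun p => x * F p + y * G p) = x * sum3 k F + y * sum3 k G.
Proof.
rewrite /sum3 !mulr_sumr -big_split /=; apply: eq_bigr => a _.
rewrite !mulr_sumr -big_split /=; apply: eq_bigr => b _.
by rewrite !mulr_sumr -big_split /=.
Qed.

(** The point whose coordinate along [q] is the last argument, so that the
    innermost sum can be taken along any chosen axis. *)
Definition assemble (q : dir) (a b c : nat) : vec3 nat :=
  match q with X => (c, a, b) | Y => (b, c, a) | Z => (a, b, c) end.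

Lemma sum3_assemble q k F : sum3 k F =
  \sum_(a <- index_range (k (nx q)) (pr (nx q) M)) \sum_(b <- index_range (k (pv q)) (pr
    (pv q) M))
    \sum_(c <- index_range (k q) (pr q M)) F (assemble q a b c).
Proof.
case: q => //=; rewrite /sum3 /=.
- rewrite exchange_big /=; apply: eq_bigr => b _; exact: exchange_big.
- rewrite [RHS]exchange_big /=; apply: eq_bigr => a _; exact: exchange_big.
Qed.

Lemma assemble_pr q a b c : [/\ pr q (assemble q a b c) = c, pr (nx q) (assemble q a b c) = a &
  pr (pv q) (assemble q a b c) = b].
Proof. by case: q. Qed.

Lemma assemble_up q a b c : up q (assemble q a b c) = assemble q a b c.+1.
Proof. by case: q. Qed.
Lemma assemble_dn q a b c : dn q (assemble q a b c) = assemble q a b c.-1.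
Proof. by case: q. Qed.

Definition in_range_but q k p : Prop := forall c, c != q ->
  pr c p \in index_range (k c) (pr c M).

Lemma assemble_in q k a b c : a \in index_range (k (nx q)) (pr (nx q) M) ->
  b \in index_range (k (pv q)) (pr (pv q) M) -> in_range_but q k (assemble q a b c).
Proof. by case: q => /= Ha Hb [] // _. Qed.

Lemma summation_by_parts q k k' F G : k q = Int -> k' q = Half -> (forall c, c != q ->
  k c = k' c) ->
  (forall p, in_range_but q k p -> on_bnd M q p -> G p = 0) ->
  sum3 k (fun p => G p * delta M q F p) = - sum3 k' (fun p => F p * delta M q G p).
Proof.
move=> kq k'q kk' G0; rewrite !(sum3_assemble q) kq k'q -!kk'; [|by case: (q)|by case: (q)].
rewrite -sumrN; apply: eq_big_seq => a Ha; rewrite -sumrN; apply: eq_big_seq => b Hb.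
have Gb c : c = 0%N \/ c = (pr q M).*2 -> G (assemble q a b c) = 0.
  move=> Hc; apply: G0; first exact: assemble_in.
  by rewrite /on_bnd; have [-> _ _] := assemble_pr q a b c.
have := @summation_by_parts1 R (pr q M) (fun c => F (assemble q a b c)) (fun c => G
  (assemble q a b c) / mesh M q)
  (M_gt0 q).
rewrite !Gb; [|by right|by left]; rewrite !mul0r => /(_ erefl erefl) /= E.
transitivity (\sum_(i <- index_range Int (pr q M)) (F (assemble q a b i.+1) - F (assemble q
  a b i.-1)) *
     (G (assemble q a b i) / mesh M q)).
  by apply: eq_bigr => c _; rewrite /delta assemble_up assemble_dn; ring.
by rewrite E; congr (- _); apply: eq_bigr => c _; rewrite /delta assemble_up assemble_dn; ring.
Qed.

Lemma sum3_IntB q k k' F : k q = IntB -> k' q = Int -> (forall c, c != q -> k c = k' c) ->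
  (forall p, in_range_but q k p -> on_bnd M q p -> F p = 0) ->
  sum3 k F = sum3 k' F.
Proof.
move=> kq k'q kk' F0; rewrite !(sum3_assemble q) kq k'q -!kk'; [|by case: (q)|by case: (q)].
apply: eq_big_seq => a Ha; apply: eq_big_seq => b Hb.
apply: sum_IntB => //; apply: F0; rewrite /on_bnd; try exact: assemble_in.
  by have [-> _ _] := assemble_pr q a b 0; left.
by have [-> _ _] := assemble_pr q a b (pr q M).*2; right.
Qed.

Lemma size_index_range (k : kind) n : (0 < n)%N -> (size (index_range k n) <= n.*2)%N.
Proof.
move=> n0; case: k; rewrite size_map size_iota.
- by rewrite subn0 -addnn leq_addr.
- by rewrite -addnn (leq_trans (leq_subr _ _))// leq_addr.
- by rewrite subn0 -addnn -addn1 leq_add2l.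
Qed.

(** The factor 8 is [2^3]: a range has at most twice as many points as there are
    cells. *)
Lemma sum3_const k (L : R) : 0 <= L ->
  sum3 k (fun=> L) <= 8 * L * ((pr X M)%:R * (pr Y M)%:R * (pr Z M)%:R).
Proof.
move=> L0; rewrite /sum3 !big_const_seq !count_predT !iter_addr_0.
have h q : (size (index_range (k q) (pr q M)))%:R <= 2 * (pr q M)%:R :> R.
  by rewrite -natrM ler_nat mul2n; exact: size_index_range.
rewrite -!mulrnA -[L *+ _]mulr_natr !natrM.
have -> : 8 * L * ((pr X M)%:R * (pr Y M)%:R * (pr Z M)%:R) =
  L * (2 * (pr Z M)%:R * (2 * (pr Y M)%:R * (2 * (pr X M)%:R))) by ring.
by rewrite ler_wpM2l//; do 2! [apply: ler_pM => //]; rewrite ?mulr_ge0.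
Qed.
End GridSums.

(** * The energy of the scheme *)

Section Energy.
Context {R : realType}.
Variables (kap : bool -> R) (M : vec3 nat) (dt : R).
Hypothesis kap_gt0 : forall f, 0 < kap f.
Hypothesis M_gt1 : forall q, (1 < pr q M)%N.
Hypothesis dt_gt0 : 0 < dt.
Implicit Types (v w : state (R := R)) (p : vec3 nat).

Local Notation curlA := (curlA kap M).
Local Notation curlB := (curlB kap M).
Local Notation intermediate := (intermediate kap M dt).
Local Notation residual := (residual kap M dt).

Let M_gt0 q : (0 < pr q M)%N. Proof. exact: ltn_trans (M_gt1 q). Qed.

Definition comp_kind (f : bool) (d q : dir) : kind :=
  if f then if q == d then IntB else Half else if q == d then Half else Int.

Lemma comp_kind_grid f d p : in_range M (comp_kind f d) p -> on_grid M f d p /\ inner M f d p.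
Proof.
move=> H; have H' q := mem_index_range (M_gt0 q) (H q).
split.
  move=> q; have := H' q; rewrite /comp_kind; case: (f); case: (q == d) => -[].
  - by move=> /negPf ->.
  - by move=> -> /ltnW.
  - by move=> -> /ltnW.
  - by move=> /negPf -> /andP[_ /ltnW].
rewrite /inner; case: f H H' => //= _ H'.
have := H' (nx d); have := H' (pv d); rewrite /comp_kind.
have -> : (nx d == d) = false by case: (d).
have -> : (pv d == d) = false by case: (d).
by move=> [_ ->] [_ ->].
Qed.

Definition comp_sum f (F : dir -> vec3 nat -> R) : R :=
  sum3 M (comp_kind f X) (F X) + sum3 M (comp_kind f Y) (F Y) + sum3 M (comp_kind f Z) (F Z).

Definition dv : R := mesh M X * mesh M Y * mesh M Z.
Definition inner_prod v w : R :=
  dv * ((kap false)^-1 * comp_sum false (fun d p => v false d p * w false d p)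
        + (kap true)^-1 * comp_sum true (fun d p => v true d p * w true d p)).
Definition norm2 v : R := inner_prod v v.

Lemma dv_gt0 : 0 < dv.
Proof. by rewrite /dv !mulr_gt0// mesh_gt0. Qed.

Definition agree v w : Prop :=
  forall f d p, on_grid M f d p -> inner M f d p -> v f d p = w f d p.

Lemma comp_sum_eq f F G :
  (forall d p, on_grid M f d p -> inner M f d p -> F d p = G d p) ->
    comp_sum f F = comp_sum f G.
Proof.
move=> H; rewrite /comp_sum; congr (_ + _ + _); apply: eq_sum3 => p /comp_kind_grid[]; exact: H.
Qed.

Lemma comp_sum_lin f a b F G :
  comp_sum f (fun d p => a * F d p + b * G d p) = a * comp_sum f F + b * comp_sum f G.
Proof. by rewrite /comp_sum !sum3_lin; ring. Qed.

Lemma comp_sum_le f F G :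
  (forall d p, on_grid M f d p -> inner M f d p -> F d p <= G d p) ->
    comp_sum f F <= comp_sum f G.
Proof.
move=> H; rewrite /comp_sum; apply: lerD; [apply: lerD|]; apply: le_sum3 => p /comp_kind_grid[];
exact: H.
Qed.

Lemma inner_prod_le v w v' w' : (forall f d p, on_grid M f d p -> inner M f d p ->
    v f d p * w f d p <= v' f d p * w' f d p) -> inner_prod v w <= inner_prod v' w'.
Proof.
move=> H; rewrite /inner_prod ler_pM2l ?dv_gt0//; apply: lerD; rewrite ler_pM2l ?invr_gt0//;
by apply: comp_sum_le => d p; exact: H.
Qed.

Lemma inner_prod_eq v w v' w' : (forall f d p, on_grid M f d p -> inner M f d p ->
    v f d p * w f d p = v' f d p * w' f d p) -> inner_prod v w = inner_prod v' w'.
Proof. by move=> H; rewrite /inner_prod; congr (_ * (_ * _ + _ * _));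
  apply: comp_sum_eq => d p; exact: H. Qed.

Lemma norm2_eq v w : agree v w -> norm2 v = norm2 w.
Proof. by move=> H; apply: inner_prod_eq => f d p g i; rewrite H. Qed.

Lemma inner_prod_comb v w v1 w1 v2 w2 (a b : R) :
  (forall f d p, v f d p * w f d p = a * (v1 f d p * w1 f d p) + b * (v2 f d p * w2 f d p)) ->
  inner_prod v w = a * inner_prod v1 w1 + b * inner_prod v2 w2.
Proof.
move=> H; rewrite /inner_prod.
have E f : comp_sum f (fun d p => v f d p * w f d p) =
  a * comp_sum f (fun d p => v1 f d p * w1 f d p) + b * comp_sum f (fun d p => v2 f d p *
    w2 f d p).
  by rewrite -comp_sum_lin; apply: comp_sum_eq => d p _ _; exact: H.
by rewrite !E; ring.
Qed.

Lemma norm2_ge0 v : 0 <= norm2 v.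
Proof.
have -> : 0 = inner_prod (fun _ _ _ => 0) (fun _ _ _ => 0).
  have := @inner_prod_comb (fun _ _ _ => 0) (fun _ _ _ => 0) v v v v 0 0.
  by rewrite !mul0r addr0 => ->// f d p; ring.
by apply: inner_prod_le => f d p _ _; rewrite mulr0 -expr2 sqr_ge0.
Qed.

Lemma norm2_lincomb v w (a b : R) :
  norm2 (lincomb a v b w) = a ^+ 2 * norm2 v + b ^+ 2 * norm2 w + 2 * a * b * inner_prod v w.
Proof.
rewrite /norm2.
rewrite (@inner_prod_comb _ _ (lincomb a v b w) v (lincomb a v b w) w a b);
  last by move=> f d p; rewrite /lincomb; ring.
rewrite (@inner_prod_comb (lincomb a v b w) v v v v w a b);
  last by move=> f d p; rewrite /lincomb; ring.
rewrite (@inner_prod_comb (lincomb a v b w) w v w w w a b);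
  last by move=> f d p; rewrite /lincomb; ring.
by ring.
Qed.

(** Used in place of the triangle inequality, which would require the square root
    of [norm2]; the difference of the two sides is [eta] times a [norm2]. *)
Lemma norm2_young v w (a eta : R) : 0 < eta ->
  norm2 (lincomb 1 v a w) <= (1 + eta) * norm2 v + (1 + eta^-1) * a ^+ 2 * norm2 w.
Proof.
move=> e0; rewrite -subr_ge0.
have -> : (1 + eta) * norm2 v + (1 + eta^-1) * a ^+ 2 * norm2 w - norm2 (lincomb 1 v a w) =
  eta * norm2 (lincomb 1 v (- (a / eta)) w).
  by rewrite !norm2_lincomb; field; rewrite gt_eqF.
by rewrite mulr_ge0 ?norm2_ge0// ltW.
Qed.

Lemma norm2_bound v (L : R) : 0 <= L ->
  (forall f d p, on_grid M f d p -> inner M f d p -> `|v f d p| <= L) ->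
  norm2 v <= 24 * ((kap false)^-1 + (kap true)^-1) * L ^+ 2.
Proof.
move=> L0 H.
have L2 : 0 <= L ^+ 2 by exact: sqr_ge0.
set N := (pr X M)%:R * (pr Y M)%:R * (pr Z M)%:R : R.
have dvN : dv * N = 1.
  have M0 q : (pr q M)%:R != 0 :> R by rewrite pnatr_eq0 -lt0n.
  have hE q : mesh M q = (pr q M)%:R^-1 by rewrite /mesh; case: (q).
  by rewrite /dv /N !hE; field; rewrite (M0 X) (M0 Y) (M0 Z).
have S f : comp_sum f (fun d p => v f d p * v f d p) <= 24 * L ^+ 2 * N.
  have -> : 24 * L ^+ 2 * N = 8 * L ^+ 2 * N + 8 * L ^+ 2 * N + 8 * L ^+ 2 * N by ring.
  apply: le_trans (@comp_sum_le f _ (fun _ _ => L ^+ 2) _) _.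
    move=> d p g i; rewrite -expr2 -real_normK ?num_real// lerXn2r ?nnegrE//.
    exact: H.
  by rewrite /comp_sum; apply: lerD; [apply: lerD|]; apply: sum3_const.
have -> : 24 * ((kap false)^-1 + (kap true)^-1) * L ^+ 2 =
  dv * ((kap false)^-1 * (24 * L ^+ 2 * N) + (kap true)^-1 * (24 * L ^+ 2 * N)).
  by rewrite -[LHS]mul1r -dvN; ring.
rewrite /norm2 /inner_prod ler_pM2l ?dv_gt0//.
by apply: lerD; rewrite ler_pM2l ?invr_gt0.
Qed.

Definition pec_state v : Prop :=
  forall d p, on_grid M false d p -> ~~ inner M false d p -> v false d p = 0.

Lemma pec_state_bnd v d q p : pec_state v -> on_grid M false d p -> q != d -> on_bnd M q p ->
  v false d p = 0.
Proof.
move=> Hv g qd Hq; apply: Hv => //; rewrite /inner /=.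
have : (q == nx d) || (q == pv d) by case: (q) (d) qd => -[].
move=> /orP[] /eqP E; move: Hq; rewrite /on_bnd E => -[] ->;
  by rewrite ?ltnn ?andbF.
Qed.

(** Here [d], [c], [q] are the three axes. The sum over the magnetic grid has two
    more layers along [c], on which the difference of the tangential component
    [d] vanishes; the same component vanishes at both ends of the lines along
    [q], so that summation by parts leaves no boundary term. *)
Lemma pairing v d c q : pec_state v -> d != c -> d != q -> c != q ->
  sum3 M (comp_kind false d) (fun p => v false d p * delta M q (v true c) p)
  = - sum3 M (comp_kind true c) (fun p => v true c p * delta M q (v false d) p).
Proof.
move=> Hv dc dq cq.
have cd : c != d by rewrite eq_sym.
have qd : q != d by rewrite eq_sym.
have qc : q != c by rewrite eq_sym.
have cover x : [|| x == d, x == c | x == q] by case: (x) (d) (c) (q) dc dq cq => -[] [] [].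
pose km x := if x == c then Int else Half.
rewrite (@sum3_IntB _ M M_gt1 c (comp_kind true c) km); first last.
- move=> p Hp bc.
  have gE p' : pr d p' = pr d p -> pr c p' = pr c p ->
     (pr q p' <= (pr q M).*2)%N -> odd (pr q p') = false -> v false d p' = 0.
    move=> Ed Ec Hq Oq; apply: (pec_state_bnd (q := c) Hv _ cd); last by rewrite /on_bnd Ec.
    move=> x; have := cover x; case/or3P => /eqP ->.
    + rewrite Ed eqxx; have := mem_index_range (M_gt0 d) (Hp d dc).
      by rewrite /comp_kind (negPf dc) => -[-> /ltnW].
    + rewrite Ec (negPf cd); case: bc => ->; first by [].
      by rewrite odd_double.
    + by rewrite (negPf qd) Oq.
  have [oq ltq] : odd (pr q p) /\ (pr q p < (pr q M).*2)%N.
    by have := mem_index_range (M_gt0 q) (Hp q qc); rewrite /comp_kind (negPf qc).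
  rewrite /delta !gE ?subrr ?mul0r ?mulr0//.
  all: rewrite ?pr_up ?pr_dn ?(negPf dq) ?(negPf cq) ?eqxx//.
  + exact: leq_trans (leq_pred _) (ltnW ltq).
  + by move: oq; case: (pr q p) => //= n /negbTE.
  + by rewrite /= oq.
- by move=> x xc; rewrite /km /comp_kind (negPf xc).
- by rewrite /km eqxx.
- by rewrite /comp_kind eqxx.
apply: (summation_by_parts M_gt1).
- by rewrite /comp_kind (negPf qd).
- by rewrite /km (negPf qc).
- move=> x xq; have := cover x; case/or3P => /eqP E;
  rewrite E /comp_kind /km ?eqxx ?(negPf cd) ?(negPf dc)//.
  by rewrite E eqxx in xq.
move=> p Hp bq; apply: (pec_state_bnd (q := q) Hv _ qd bq) => x.
have := cover x; case/or3P => /eqP ->.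
+ have := mem_index_range (M_gt0 d) (Hp d dq); rewrite /comp_kind eqxx => -[-> /ltnW]//.
+ have := mem_index_range (M_gt0 c) (Hp c cq);
  rewrite /comp_kind (negPf cd) => -[/negPf -> /andP[_ /ltnW]]//.
+ rewrite (negPf qd); case: bq => ->; first by [].
  by rewrite odd_double.
Qed.

Lemma curlA_skew v : pec_state v -> inner_prod v (curlA v) = 0.
Proof.
move=> Hv; have E f : (kap f)^-1 * comp_sum f (fun d p => v f d p * curlA v f d p) =
    comp_sum f (fun d p => v f d p * delta M (dirA f d) (v (~~ f) (dirB f d)) p).
  have := @comp_sum_lin f (kap f)^-1 0 (fun d p => v f d p * curlA v f d p) (fun _ _ => 0).
  rewrite [0 * comp_sum _ _]mul0r addr0 => <-; apply: comp_sum_eq => d p _ _.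
  by rewrite /curlA; field; rewrite gt_eqF.
rewrite /inner_prod !E /comp_sum /= (pairing (d := X) (c := Z) (q := Y))//.
by rewrite (pairing (d := Y) (c := X) (q := Z))// (pairing (d := Z) (c := Y) (q := X))//; ring.
Qed.

Lemma curlB_skew v : pec_state v -> inner_prod v (curlB v) = 0.
Proof.
move=> Hv; have E f : (kap f)^-1 * comp_sum f (fun d p => v f d p * curlB v f d p) =
    - comp_sum f (fun d p => v f d p * delta M (dirB f d) (v (~~ f) (dirA f d)) p).
  have := @comp_sum_lin f (- (kap f)^-1) 0 (fun d p => v f d p * curlB v f d p) (fun _ _ => 0).
  rewrite [0 * comp_sum _ _]mul0r addr0 mulNr => /(congr1 -%R); rewrite opprK => <-;
    congr (- _).
  by apply: comp_sum_eq => d p _ _; rewrite /curlB; field; rewrite gt_eqF.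
rewrite /inner_prod !E /comp_sum /= (pairing (d := X) (c := Y) (q := Z))//.
by rewrite (pairing (d := Y) (c := Z) (q := X))// (pairing (d := Z) (c := X) (q := Y))//; ring.
Qed.

(** Equal to the squared norms of both [(1 + dt/2 B) v] and [(1 - dt/2 B) v] when
    [v] satisfies the boundary condition. *)
Definition energy v : R := norm2 v + (dt / 2) ^+ 2 * norm2 (curlB v).

Lemma energy_ge0 v : 0 <= energy v.
Proof.
apply: addr_ge0; first exact: norm2_ge0.
by apply: mulr_ge0; [exact: sqr_ge0|exact: norm2_ge0].
Qed.

Lemma norm2_skew v w (a : R) : inner_prod v w = 0 ->
  norm2 (lincomb 1 v a w) = norm2 v + a ^+ 2 * norm2 w.
Proof. by move=> E; rewrite norm2_lincomb E; ring. Qed.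

Lemma intermediate_pec v0 v1 : pec_state (intermediate v0 v1).
Proof. by move=> d p _ /negPf i; rewrite /intermediate i. Qed.

(** In terms of the states [s = intermediate v0 v1] and [r = residual v0 v1],
    [(1 - tau B) v1 = (1 + tau A) s + tau r] and
    [(1 - tau A) s = (1 + tau B) v0 + tau r]; skewness makes the left-hand side of
    the second relation as long as [(1 + tau A) s]. *)
Lemma energy_step v0 v1 (eta : R) : 0 < eta -> pec_state v0 -> pec_state v1 ->
  energy v1 <= (1 + eta) ^+ 2 * energy v0
          + (2 + eta) * (1 + eta^-1) * (dt / 2) ^+ 2 * norm2 (residual v0 v1).
Proof.
move=> e0 H0 H1; set s := intermediate v0 v1; have Hs : pec_state s by exact: intermediate_pec.
have d0 : dt != 0 by rewrite gt_eqF.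
have E1 : norm2 (lincomb 1 v1 (- (dt / 2)) (curlB v1)) =
          norm2 (lincomb 1 (lincomb 1 s (dt / 2) (curlA s)) (dt / 2) (residual v0 v1)).
  apply: norm2_eq => f d p g i; rewrite /lincomb /residual -/s {1}/s /intermediate i;
    field; exact: d0.
have E2 : norm2 (lincomb 1 s (- (dt / 2)) (curlA s)) =
          norm2 (lincomb 1 (lincomb 1 v0 (dt / 2) (curlB v0)) (dt / 2) (residual v0 v1)).
  apply: norm2_eq => f d p g i; rewrite /lincomb /residual -/s {1}/s /intermediate i;
    field; exact: d0.
have Y1 := norm2_young (lincomb 1 s (dt / 2) (curlA s)) (residual v0 v1) (dt / 2) e0.
have Y2 := norm2_young (lincomb 1 v0 (dt / 2) (curlB v0)) (residual v0 v1) (dt / 2) e0.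
rewrite -E1 in Y1; rewrite -E2 in Y2.
rewrite !(norm2_skew _ (curlB_skew _))// sqrrN -/(energy v1) in Y1.
rewrite !(norm2_skew _ (curlA_skew Hs)) in Y1 Y2.
rewrite !(norm2_skew _ (curlB_skew _))// sqrrN -/(energy v0) in Y2.
apply: le_trans Y1 _.
have e1 : 0 <= 1 + eta by lra.
have := ler_wpM2l e1 Y2; rewrite [X in _ <= X -> _]mulrDr.
set q := norm2 (residual _ _); set c := (1 + eta^-1) * (dt / 2) ^+ 2 * q.
have -> : (2 + eta) * (1 + eta^-1) * (dt / 2) ^+ 2 * q = (2 + eta) * c.
  by rewrite /c; ring.
have -> : (1 + eta) * ((1 + eta) * energy v0) = (1 + eta) ^+ 2 * energy v0 by ring.
lra.
Qed.

(** The step estimate is used with [eta = 1/N]: at most [N] steps then multiply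
    the energy by at most [(1 + 1/N)^(2N)], and each step adds a multiple of
    [1/N]. *)
Lemma energy_bound (N n : nat) (T q : R) (v : nat -> state (R := R)) :
  dt = T / N%:R -> (n <= N)%N -> (0 < N)%N ->
  (forall m, (m <= n)%N -> pec_state (v m)) ->
  (forall m, (m < n)%N -> norm2 (residual (v m) (v m.+1)) <= q) -> 0 <= q ->
  energy (v n) <= expR 2 * (energy (v 0%N) + 3 / 2 * T ^+ 2 * q).
Proof.
move=> dtE nN N0 Hp Hq q0.
have N0' : 0 < N%:R :> R by rewrite ltr0n.
set eta : R := N%:R^-1; have e0 : 0 < eta by rewrite invr_gt0.
set c := 3 / 2 * T ^+ 2 * q * eta.
have c0 : 0 <= c.
  apply: mulr_ge0; last exact: ltW.
  by apply: mulr_ge0 => //; apply: mulr_ge0; [lra|exact: sqr_ge0].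
have step m : (m < n)%N -> energy (v m.+1) <= (1 + eta) ^+ 2 * (energy (v m) + c).
  move=> mn; have := energy_step e0 (Hp m (ltnW mn)) (Hp m.+1 mn).
  move=> /le_trans; apply; rewrite [leRHS]mulrDr lerD2l.
  have e1 : eta <= 1 by rewrite invf_le1// ler1n.
  have : (2 + eta) * (1 + eta^-1) * (dt / 2) ^+ 2 * norm2 (residual (v m) (v m.+1)) <=
     (2 + eta) * (1 + eta^-1) * (dt / 2) ^+ 2 * q.
    rewrite ler_wpM2l ?Hq//; apply: mulr_ge0; last exact: sqr_ge0.
    by apply: mulr_ge0; [lra|rewrite addr_ge0// invr_ge0 ltW].
  move=> /le_trans; apply.
  have -> : (2 + eta) * (1 + eta^-1) * (dt / 2) ^+ 2 * q =
     (2 + eta) * (1 + eta) / 6 * c.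
    rewrite dtE /c /eta; field; exact: lt0r_neq0.
  rewrite ler_wpM2r//.
  rewrite -subr_ge0; have -> : (1 + eta) ^+ 2 - (2 + eta) * (1 + eta) / 6 =
     (1 + eta) * (4 + 5 * eta) / 6 by field.
  by rewrite divr_ge0// mulr_ge0; lra.
have iter m : (m <= n)%N -> energy (v m) <= (1 + eta) ^+ (2 * m) * (energy (v 0%N) + m%:R * c).
  elim: m => [|m IH] mn; first by rewrite muln0 expr0 mul1r mul0r addr0.
  apply: le_trans (step m mn) _.
  rewrite mulnS exprD -mulrA ler_wpM2l ?sqr_ge0// -natr1 mulrDl mul1r addrA mulrDr.
  apply: lerD; first exact: IH (ltnW mn).
  by rewrite ler_peMl// exprn_ege1// lerDl ltW.
apply: le_trans (iter n (leqnn _)) _.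
apply: ler_pM.
- by rewrite exprn_ge0// addr_ge0// ltW.
- by rewrite addr_ge0 ?energy_ge0// mulr_ge0.
- apply: le_trans (_ : (1 + eta) ^+ (2 * N) <= _).
    by rewrite ler_weXn2l ?leq_mul2l// lerDl ltW.
  apply: le_trans (_ : (expR eta) ^+ (2 * N) <= _).
    by rewrite lerXn2r ?nnegrE ?expR_ge0 ?expR_ge1Dx// addr_ge0// ltW.
  rewrite -expRM_natl natrM /eta -mulrA mulfV ?mulr1//.
  exact: lt0r_neq0.
- have -> : 3 / 2 * T ^+ 2 * q = N%:R * c.
    by rewrite /c /eta; field; exact: lt0r_neq0.
  by rewrite lerD2l ler_wpM2r// ler_nat.
Qed.
End Energy.

(** * The numerical solution as a sequence of states *)

Section GridNeighbours.
Variable M : vec3 nat.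
Implicit Types (p : vec3 nat).

(** Along the axis [q] a component [d] of one field is surrounded by the component
    of the other field in the remaining direction [c]. *)
Lemma third_dir f (d q c x : dir) : q != d -> c != d -> c != q ->
  ((x == c) (+) ~~ f) = ((x == d) (+) f) (+) (x == q).
Proof. by case: f; case: x; case: d; case: q; case: c. Qed.

Lemma odd_interior d p q f : on_grid M f d p -> (q == d) (+) f ->
  (0 < pr q p < (pr q M).*2)%N.
Proof.
move=> Hp qd; have [px ox] := Hp q; rewrite qd in ox.
rewrite odd_gt0// ltn_neqAle px andbT; apply/eqP => E.
by rewrite E odd_double in ox.
Qed.

Lemma inner_interior f d p q : on_grid M f d p -> inner M f d p -> q != d ->
  (0 < pr q p < (pr q M).*2)%N.
Proof.
move=> g i qd; case: f g i => g i.
  by apply: (odd_interior g); rewrite (negPf qd).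
by move: i => /andP[]; case: (q) (d) qd => -[].
Qed.

Lemma on_grid_up f d q c p : on_grid M f d p -> inner M f d p ->
  q != d -> c != d -> c != q -> on_grid M (~~ f) c (up q p).
Proof.
move=> g i qd cd cq x; have [xM ox] := g x; rewrite (third_dir f x qd cd cq) -ox pr_up.
have /andP[_ lq] := inner_interior g i qd.
by case: eqP => [->|_]; rewrite ?addbT ?addbF.
Qed.

Lemma on_grid_dn f d q c p : on_grid M f d p -> inner M f d p ->
  q != d -> c != d -> c != q -> on_grid M (~~ f) c (dn q p).
Proof.
move=> g i qd cd cq x; have [xM ox] := g x; rewrite (third_dir f x qd cd cq) -ox pr_dn.
have /andP[q0 lq] := inner_interior g i qd.
case: eqP => [->|_]; rewrite ?addbT ?addbF//; split.
  exact: leq_trans (leq_pred _) (ltnW lq).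
by rewrite -{2}(prednK q0) /= negbK.
Qed.

Lemma odd_idx a : odd a -> a = half_idx a./2.
Proof. by move=> oa; rewrite -{1}(odd_double_half a) oa. Qed.
Lemma even_idx a : odd a = false -> a = int_idx a./2.
Proof. by move=> oa; rewrite -{1}(odd_double_half a) oa. Qed.
Lemma half_lt a n : odd a -> (a <= n.*2)%N -> (a./2 < n)%N.
Proof.
move=> oa; rewrite {1}(odd_idx oa) /half_idx => H.
by rewrite -ltn_double; exact: H.
Qed.
Lemma half_le a n : (a <= n.*2)%N -> (a./2 <= n)%N.
Proof. by move=> /half_leq; rewrite doubleK. Qed.
Lemma even_lt a n : odd a = false -> (0 < a < n.*2)%N -> (0 < a./2 < n)%N.
Proof. by move=> /even_idx E; rewrite {1 2}E /int_idx double_gt0 ltn_double. Qed.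

(** Parity recovers the integer and half-integer indices of the scheme from a
    point of a staggered grid, which transfers the six equations of each stage to
    one statement on components. *)
Lemma grid_cases f d a b c (P : nat -> nat -> nat -> Prop) :
  on_grid M f d (a, b, c) ->
  (if f then match d with X => on_Hx M P | Y => on_Hy M P | Z => on_Hz M P end
   else match d with X => on_Ex M P | Y => on_Ey M P | Z => on_Ez M P end) ->
  P a b c.
Proof.
move=> g; have [la oa] : (a <= (pr X M).*2)%N /\ odd a = (X == d) (+) f := g X.
have [lb ob] : (b <= (pr Y M).*2)%N /\ odd b = (Y == d) (+) f := g Y.
have [lc oc] : (c <= (pr Z M).*2)%N /\ odd c = (Z == d) (+) f := g Z.
case: f d oa ob oc {g} => -[] /= oa ob oc H;
 [rewrite (even_idx oa) (odd_idx ob) (odd_idx oc)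
 |rewrite (odd_idx oa) (even_idx ob) (odd_idx oc)
 |rewrite (odd_idx oa) (odd_idx ob) (even_idx oc)
 |rewrite (odd_idx oa) (even_idx ob) (even_idx oc)
 |rewrite (even_idx oa) (odd_idx ob) (even_idx oc)
 |rewrite (even_idx oa) (even_idx ob) (odd_idx oc)]; apply: H;
 by [exact: half_lt|exact: half_le].
Qed.

Lemma inner_cases f d a b c (P : nat -> nat -> nat -> Prop) :
  on_grid M f d (a, b, c) -> inner M f d (a, b, c) ->
  (if f then match d with X => on_Hx M P | Y => on_Hy M P | Z => on_Hz M P end
   else match d with
        | X => interior_Ex M P | Y => interior_Ey M P | Z => interior_Ez M P end) ->
  P a b c.
Proof.
case: f => g i H; first exact: grid_cases g H.
have I q := inner_interior (q := q) g i.
have [la oa] : (a <= (pr X M).*2)%N /\ odd a = (X == d) (+) false := g X.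
have [lb ob] : (b <= (pr Y M).*2)%N /\ odd b = (Y == d) (+) false := g Y.
have [lc oc] : (c <= (pr Z M).*2)%N /\ odd c = (Z == d) (+) false := g Z.
case: d oa ob oc H I {g i} => /= oa ob oc H I;
 [rewrite (odd_idx oa) (even_idx ob) (even_idx oc)
 |rewrite (even_idx oa) (odd_idx ob) (even_idx oc)
 |rewrite (even_idx oa) (even_idx ob) (odd_idx oc)]; apply: H;
 by [exact: half_lt|apply: even_lt => //; exact: (I X)|
   apply: even_lt => //; exact: (I Y)|apply: even_lt => //; exact: (I Z)].
Qed.
End GridNeighbours.

Section NumericalSolution.
Context {R : realType}.
Variables (M : vec3 nat) (N : nat) (dt eps mu : R) (E0 H0 : vec3 R -> vec3 R).
Variables (E H : vec3 (gridfun R)).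
Hypothesis scheme : adi_fdtd M N dt eps mu E0 H0 E H.
Hypotheses (dt_gt0 : 0 < dt) (eps_gt0 : 0 < eps) (mu_gt0 : 0 < mu).
Implicit Types (p : vec3 nat).

Local Notation kap := (kappa eps mu).

Definition grid_state (VE VH : vec3 (gridfun R)) (m : nat) : state (R := R) :=
  fun f d p => pr d (if f then VH else VE) m (cx p) (cy p) (cz p).

Local Notation num := (grid_state E H).

Lemma num_pec m : (m <= N.*2)%N -> pec_state M (num m).
Proof.
move=> mN d [[a b] c] g i; have [_ /(_ m mN) [PX [PY PZ]] _] := scheme.
have := g; move=> /grid_cases.
move=> /(_ (fun a b c => match d with
  | X => [\/ b = 0%N, b = int_idx (cy M), c = 0%N | c = int_idx (cz M)]
  | Y => [\/ a = 0%N, a = int_idx (cx M), c = 0%N | c = int_idx (cz M)]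
  | Z => [\/ a = 0%N, a = int_idx (cx M), b = 0%N | b = int_idx (cy M)]
  end -> num m false d (a, b, c) = 0)) /=.
have edge q : ~~ (0 < pr q (a, b, c) < (pr q M).*2)%N ->
    pr q (a, b, c) = 0%N \/ pr q (a, b, c) = int_idx (pr q M).
  rewrite negb_and -!leqNgt leqn0 => /orP[/eqP|]; [by left|right].
  by apply/eqP; rewrite eqn_leq; have [-> _] := g q.
case: d g i => g i F; apply: F => //; move: i;
  rewrite /inner orFb negb_and => /orP[/edge|/edge] /= [] B;
  by [exact: Or41 B|exact: Or42 B|exact: Or43 B|exact: Or44 B].
Qed.

Lemma inv_double (x : R) : 0 < x -> (2 * x)^-1 = x^-1 / 2.
Proof. by move=> x0; rewrite invfM mulrC. Qed.

Lemma stage1 n f d p : (n < N)%N -> on_grid M f d p -> inner M f d p ->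
  (num n.*2.+1 f d p - num n.*2 f d p) / dt =
  (curlA kap M (num n.*2.+1) f d p + curlB kap M (num n.*2) f d p) / 2.
Proof.
move=> nN; have [_ _ /(_ n nN) [S1 _]] := scheme.
case: p => [[a b] c] g i; have := inner_cases g i.
move/(_ (fun a b c => (num n.*2.+1 f d (a, b, c) - num n.*2 f d (a, b, c)) / dt =
  (curlA kap M (num n.*2.+1) f d (a, b, c) + curlB kap M (num n.*2) f d (a, b, c)) / 2)).
apply; case: S1 => [SEX [SEY [SEZ [SHX [SHY SHZ]]]]].
have half (k x y z : R) : 0 < k -> z = (2 * k)^-1 * (x - y) ->
    z = (k^-1 * x + - (k^-1 * y)) / 2.
  by move=> k0 ->; rewrite inv_double//; ring.
case: f {g i}; case: d => i j k Hi Hj Hk; apply: half => //.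
- exact: SHX.
- exact: SHY.
- exact: SHZ.
- exact: SEX.
- exact: SEY.
- exact: SEZ.
Qed.

Lemma stage2 n f d p : (n < N)%N -> on_grid M f d p -> inner M f d p ->
  (num n.+1.*2 f d p - num n.*2.+1 f d p) / dt =
  (curlA kap M (num n.*2.+1) f d p + curlB kap M (num n.+1.*2) f d p) / 2.
Proof.
move=> nN; have [_ _ /(_ n nN) [_ S2]] := scheme.
case: p => [[a b] c] g i; have := inner_cases g i.
move/(_ (fun a b c => (num n.+1.*2 f d (a, b, c) - num n.*2.+1 f d (a, b, c)) / dt =
  (curlA kap M (num n.*2.+1) f d (a, b, c) + curlB kap M (num n.+1.*2) f d (a, b, c)) / 2)).
apply; case: S2 => [SEX [SEY [SEZ [SHX [SHY SHZ]]]]].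
have half (k x y z : R) : 0 < k -> z = (2 * k)^-1 * (x - y) ->
    z = (k^-1 * x + - (k^-1 * y)) / 2.
  by move=> k0 ->; rewrite inv_double//; ring.
case: f {g i}; case: d => i j k Hi Hj Hk; apply: half => //.
- exact: SHX.
- exact: SHY.
- exact: SHZ.
- exact: SEX.
- exact: SEY.
- exact: SEZ.
Qed.

(** Subtracting the two stages eliminates the implicit part. *)
Lemma intermediate_num n f d p : (n < N)%N -> on_grid M f d p ->
  intermediate kap M dt (num n.*2) (num n.+1.*2) f d p = num n.*2.+1 f d p.
Proof.
move=> nN g; rewrite /intermediate; case: ifPn => i; last first.
  have f0 : f = false by case: f i {g}.
  rewrite f0 in g i *; rewrite num_pec//.
  by rewrite ltn_double.
have d0 : dt != 0 by rewrite gt_eqF.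
have := stage1 nN g i; have := stage2 nN g i.
move=> /(congr1 (fun z => z * dt)); rewrite divfK// => A.
move=> /(congr1 (fun z => z * dt)); rewrite divfK// => B.
lra.
Qed.

Lemma residual_num n f d p : (n < N)%N -> on_grid M f d p -> inner M f d p ->
  residual kap M dt (num n.*2) (num n.+1.*2) f d p = 0.
Proof.
move=> nN g i; rewrite /residual.
have -> : curlA kap M (intermediate kap M dt (num n.*2) (num n.+1.*2)) f d p =
          curlA kap M (num n.*2.+1) f d p.
  rewrite /curlA /delta !intermediate_num//.
    by apply: on_grid_dn; rewrite ?dirA_neq ?dirB_neq// eq_sym dirA_neq_dirB.
  by apply: on_grid_up; rewrite ?dirA_neq ?dirB_neq// eq_sym dirA_neq_dirB.
have d0 : dt != 0 by rewrite gt_eqF.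
have := stage1 nN g i; have := stage2 nN g i.
have -> : (num n.+1.*2 f d p - num n.*2 f d p) / dt =
  (num n.+1.*2 f d p - num n.*2.+1 f d p) / dt
  + (num n.*2.+1 f d p - num n.*2 f d p) / dt by field.
by move=> -> ->; field.
Qed.
End NumericalSolution.

(** * Error estimates *)

Section ErrorEstimate.
Context {R : realType}.
Variables (kap : bool -> R) (M : vec3 nat) (N : nat) (dt T B : R).
Variables (U : field (R := R)) (w : nat -> state (R := R)).
Hypothesis kap_gt0 : forall f, 0 < kap f.
Hypothesis M_gt1 : forall q, (1 < pr q M)%N.
Hypotheses (T_gt0 : 0 < T) (N_gt0 : (0 < N)%N) (dtE : dt = T / N%:R).
Hypothesis HU : maxwell_field kap 4 T B U.
Hypothesis w_pec : forall n, (n <= N)%N -> pec_state M (w n).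
Hypothesis w_scheme : forall n f d p, (n < N)%N -> on_grid M f d p -> inner M f d p ->
  residual kap M dt (w n) (w n.+1) f d p = 0.
Hypothesis w_init : forall f d p, on_grid M f d p -> w 0%N f d p = sample M U 0 f d p.

Local Notation norm2 := (norm2 kap M).
Local Notation energy := (energy kap M dt).
Local Notation residual := (residual kap M dt).
Local Notation K := (kap_sum kap).

Definition err n : state (R := R) := lincomb 1 (sample M U (n%:R * dt)) (-1) (w n).
Definition err_dt n : state (R := R) := lincomb dt^-1 (err n.+1) (- dt^-1) (err n).

Definition mesh4 : R := dt ^+ 4 + mesh M X ^+ 4 + mesh M Y ^+ 4 + mesh M Z ^+ 4.
Definition Cres (b : R) : R :=
  96 * ((kap false)^-1 + (kap true)^-1) * ((20 * K ^+ 3 + K) * b) ^+ 2.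

Lemma dt_gt0 : 0 < dt.
Proof. by rewrite dtE divr_gt0// ltr0n. Qed.

Lemma time_le n : (n <= N)%N -> n%:R * dt <= T.
Proof.
move=> nN; have N0 : 0 < N%:R :> R by rewrite ltr0n.
have -> : T = N%:R * dt by rewrite dtE; field; rewrite gt_eqF.
by rewrite ler_wpM2r ?ler_nat// ltW// dt_gt0.
Qed.

Lemma field_const_ge0 : 0 <= B.
Proof.
apply: (field_bound_ge0 (t := 0) (maxwell_field_le (isT : 3 <= 4)%N HU)).
by rewrite lexx ltW.
Qed.

Lemma sqr_sum4_le (a x y z : R) : (a ^+ 2 + x ^+ 2 + y ^+ 2 + z ^+ 2) ^+ 2 <=
  4 * (a ^+ 4 + x ^+ 4 + y ^+ 4 + z ^+ 4).
Proof.
rewrite -subr_ge0.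
have -> : 4 * (a ^+ 4 + x ^+ 4 + y ^+ 4 + z ^+ 4) - (a ^+ 2 + x ^+ 2 + y ^+ 2 + z ^+ 2) ^+ 2
  = (a ^+ 2 - x ^+ 2) ^+ 2 + (a ^+ 2 - y ^+ 2) ^+ 2 + (a ^+ 2 - z ^+ 2) ^+ 2
    + (x ^+ 2 - y ^+ 2) ^+ 2 + (x ^+ 2 - z ^+ 2) ^+ 2 + (y ^+ 2 - z ^+ 2) ^+ 2 by ring.
by rewrite !addr_ge0// sqr_ge0.
Qed.

Lemma norm2_truncation b v : 0 <= b -> (forall f d p, on_grid M f d p -> inner M f d p ->
   `|v f d p| <= (20 * K ^+ 3 + K) * b *
      (dt ^+ 2 + mesh M X ^+ 2 + mesh M Y ^+ 2 + mesh M Z ^+ 2)) ->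
  norm2 v <= Cres b * mesh4.
Proof.
move=> b0 Hv; have k0 := kap_sum_gt0 kap_gt0.
have c0 : 0 <= (20 * K ^+ 3 + K) * b.
  by rewrite mulr_ge0// addr_ge0 ?mulr_ge0 ?exprn_ge0 ?(ltW k0).
set L := (20 * K ^+ 3 + K) * b * _ in Hv.
have L0 : 0 <= L by rewrite mulr_ge0// !addr_ge0// sqr_ge0.
apply: le_trans (norm2_bound kap_gt0 M_gt1 L0 Hv) _.
rewrite /L /Cres /mesh4 exprMn.
set c := (_ * b) ^+ 2.
have c1 : 0 <= c by exact: sqr_ge0.
set k := _^-1 + _^-1.
have k1 : 0 <= k by rewrite addr_ge0// invr_ge0 ltW.
have := sqr_sum4_le dt (mesh M X) (mesh M Y) (mesh M Z); set s := (_ + _) ^+ 2;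
  set s4 := _ + mesh M Z ^+ 4.
move=> Hs; have : (24 * k * c) * s <= (24 * k * c) * (4 * s4).
  by rewrite ler_wpM2l// mulr_ge0// mulr_ge0.
by congr (_ <= _); ring.
Qed.

Lemma sample_pec t : 0 <= t <= T -> pec_state M (sample M U t).
Proof.
move=> tT d p g i.
have : (~~ (0 < pr (nx d) p < (pr (nx d) M).*2) || ~~ (0 < pr (pv d) p < (pr (pv d) M).*2))%N.
  by rewrite -negb_and.
have Hle q : (pr q p <= (pr q M).*2)%N by have [] := g q.
have bnd q : (~~ (0 < pr q p < (pr q M).*2))%N -> on_bnd M q p.
  rewrite negb_and -!leqNgt leqn0 => /orP[/eqP|H]; [by left|right].
  by apply/eqP; rewrite eqn_leq H Hle.
have H3 := maxwell_field_le (isT : 3 <= 4)%N HU.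
move=> /orP[]/bnd Hb; apply: (sample_face M_gt1 H3 tT Hle Hb); by case: (d).
Qed.

Lemma lincomb_pec (a b : R) v1 v2 : pec_state M v1 -> pec_state M v2 ->
  pec_state M (lincomb a v1 b v2).
Proof. by move=> H1 H2 d p g i; rewrite /lincomb H1// H2// !mulr0 addr0. Qed.

Lemma time_ge0 n : (n <= N)%N -> 0 <= n%:R * dt <= T.
Proof. by move=> nN; rewrite time_le// mulr_ge0// ltW// dt_gt0. Qed.

Lemma err_pec n : (n <= N)%N -> pec_state M (err n).
Proof.
by move=> nN; apply: lincomb_pec; [apply: sample_pec; exact: time_ge0|exact: w_pec].
Qed.

Lemma err0 f d p : on_grid M f d p -> err 0%N f d p = 0.
Proof. by move=> g; rewrite /err /lincomb w_init// mul0r; ring. Qed.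

Lemma residual_err n f d p : (n < N)%N -> on_grid M f d p -> inner M f d p ->
  residual (err n) (err n.+1) f d p
  = residual (sample M U (n%:R * dt)) (sample M U (n%:R * dt + dt)) f d p.
Proof.
move=> nN g i; rewrite /err residual_lin w_scheme// mulr0 addr0 mul1r.
by rewrite -natr1 mulrDl mul1r.
Qed.

Lemma norm2_residual_err n : (n < N)%N -> norm2 (residual (err n) (err n.+1)) <= Cres B * mesh4.
Proof.
move=> nN; apply: norm2_truncation => [|f d p g i]; first exact: field_const_ge0.
rewrite residual_err//; have H3 := maxwell_field_le (isT : 3 <= 4)%N HU.
apply: (truncation kap_gt0 M_gt1 dt_gt0 H3) => //.
  by have /andP[] := time_ge0 (ltnW nN).
by have := time_le nN; rewrite -natr1 mulrDl mul1r.
Qed.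

Lemma residual_err_dt n f d p : (n.+1 < N)%N -> on_grid M f d p -> inner M f d p ->
  residual (err_dt n) (err_dt n.+1) f d p
  = residual (sample M (time_quotient dt U) (n%:R * dt))
       (sample M (time_quotient dt U) (n%:R * dt + dt)) f d p.
Proof.
move=> nN g i; rewrite /err_dt residual_lin !residual_err//; last exact: ltnW.
have E t : sample M (time_quotient dt U) t =
    lincomb dt^-1 (sample M U (t + dt)) (- dt^-1) (sample M U t).
  apply/funext => f'; apply/funext => d'; apply/funext => p'.
  by rewrite /sample /time_quotient /lincomb; ring.
by rewrite !E residual_lin -natr1 mulrDl mul1r.
Qed.

Lemma norm2_residual_err_dt n : (n.+1 < N)%N ->
  norm2 (residual (err_dt n) (err_dt n.+1)) <= Cres (2 * K * B) * mesh4.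
Proof.
move=> nN; have k0 := kap_sum_gt0 kap_gt0.
apply: norm2_truncation => [|f d p g i].
  by apply: mulr_ge0; [rewrite mulr_ge0// ltW|exact: field_const_ge0].
rewrite residual_err_dt//.
have H3 := time_quotient_field kap_gt0 dt_gt0 HU.
apply: (truncation kap_gt0 M_gt1 dt_gt0 H3) => //.
  by have /andP[] := time_ge0 (ltnW (ltnW nN)).
have := time_le nN; rewrite -!natr1 !mulrDl mul1r; lra.
Qed.

Lemma curlB_zero v f d p : (forall f d p, on_grid M f d p -> v f d p = 0) ->
  on_grid M f d p -> inner M f d p -> curlB kap M v f d p = 0.
Proof.
move=> Hv g i; rewrite /curlB /delta !Hv ?subrr ?mul0r ?mulr0 ?oppr0//.
  by apply: on_grid_dn => //; rewrite ?dirA_neq ?dirB_neq ?dirA_neq_dirB.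
by apply: on_grid_up => //; rewrite ?dirA_neq ?dirB_neq ?dirA_neq_dirB.
Qed.

(** On the whole grid and not only at its [inner] points, because [curlB] reads
    the boundary values. *)
Lemma energy_scale (a b : R) v1 v2 : (forall f d p, on_grid M f d p -> v2 f d p = 0) ->
  energy (lincomb a v1 b v2) = a ^+ 2 * energy v1.
Proof.
move=> Hv; rewrite /energy.
have QE u1 u2 : agree M u2 (lincomb a u1 0 u1) -> norm2 u2 = a ^+ 2 * norm2 u1.
  by move=> H; rewrite (norm2_eq kap M_gt1 H) (norm2_lincomb kap M_gt1); ring.
rewrite (QE v1 (lincomb a v1 b v2)); last by move=> f d p g i; rewrite /lincomb Hv//; ring.
rewrite (QE (curlB kap M v1) (curlB kap M (lincomb a v1 b v2))); first by ring.
by move=> f d p g i; rewrite curlB_lin (curlB_zero Hv)// /lincomb; ring.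
Qed.

Lemma energy_err0 : energy (err 0%N) = 0.
Proof.
have E : lincomb 0 (err 0%N) 1 (err 0%N) = err 0%N.
  apply/funext => f; apply/funext => d; apply/funext => p; rewrite /lincomb; ring.
by rewrite -E energy_scale ?expr0n ?mul0r//; exact: err0.
Qed.

Lemma mesh4_ge0 : 0 <= mesh4.
Proof. by rewrite /mesh4 !addr_ge0// exprn_even_ge0. Qed.

Lemma Cres_ge0 b : 0 <= Cres b.
Proof.
rewrite /Cres; apply: mulr_ge0; last exact: sqr_ge0.
by rewrite mulr_ge0// addr_ge0// invr_ge0 ltW.
Qed.

Definition Cerr : R := expR 2 *
  (3 / 2 * (1 + T ^+ 2) * (Cres B + Cres (2 * K * B))).

Lemma error_estimate n : (n < N)%N -> energy (err n.+1) <= Cerr * mesh4.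
Proof.
move=> nN.
have s0 := mesh4_ge0; have c1 := Cres_ge0 B; have c2 := Cres_ge0 (2 * K * B).
have := energy_bound kap_gt0 M_gt1 dt_gt0 (n := n.+1) (v := err) dtE nN N_gt0 _ _
  (mulr_ge0 c1 s0).
rewrite energy_err0 add0r => H; apply: le_trans (H _ _) _.
- by move=> m mn; apply: err_pec; exact: leq_trans mn nN.
- by move=> m mn; apply: norm2_residual_err; exact: leq_trans mn nN.
rewrite /Cerr -[leRHS]mulrA ler_wpM2l ?expR_ge0//.
have := sqr_ge0 T; set t := T ^+ 2 => t0.
have := mulr_ge0 c1 s0; have := mulr_ge0 c2 s0.
have := mulr_ge0 t0 (mulr_ge0 c2 s0).
set x := Cres B * mesh4; set y := Cres (_ * B) * mesh4.
have -> : 3 / 2 * (1 + t) * (Cres B + Cres (2 * K * B)) * mesh4 =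
  3 / 2 * (x + y + t * x + t * y) by rewrite /x /y; ring.
lra.
Qed.

(** The energy of [err_dt 0] is that of [err 1] divided by [dt^2]; as [err 0]
    vanishes, a single step with [eta = 1] bounds the latter by [dt^2] times the
    squared norm of the residual. *)
Lemma error_estimate_dt n : (n < N)%N -> energy (err_dt n) <= Cerr * mesh4.
Proof.
move=> nN.
have s0 := mesh4_ge0; have c1 := Cres_ge0 B; have c2 := Cres_ge0 (2 * K * B).
have := energy_bound kap_gt0 M_gt1 dt_gt0 (n := n) (v := err_dt) dtE (ltnW nN) N_gt0 _ _
  (mulr_ge0 c2 s0).
move=> H; apply: le_trans (H _ _) _.
- move=> m mn; apply: lincomb_pec; apply: err_pec.
    exact: leq_ltn_trans mn nN.
  exact: ltnW (leq_ltn_trans mn nN).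
- by move=> m mn; apply: norm2_residual_err_dt; exact: leq_ltn_trans mn nN.
rewrite /Cerr -[leRHS]mulrA ler_wpM2l ?expR_ge0//.
have d0 := dt_gt0.
have E1 : energy (err_dt 0) <= 3 / 2 * (Cres B * mesh4).
  rewrite /err_dt energy_scale; last exact: err0.
  have := energy_step kap_gt0 M_gt1 dt_gt0 ltr01 (err_pec (leq0n N)) (err_pec N_gt0).
  rewrite energy_err0 mulr0 add0r invr1 => A.
  have q := norm2_residual_err N_gt0.
  rewrite exprVn mulrC ler_pdivrMr ?exprn_gt0//.
  apply: le_trans A _.
  have -> : (2 + 1) * (1 + 1) * (dt / 2) ^+ 2 * norm2 (residual (err 0) (err 1)) =
    3 / 2 * norm2 (residual (err 0) (err 1)) * dt ^+ 2 by field.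
  by rewrite ler_wpM2r ?sqr_ge0// ler_wpM2l//; lra.
have := sqr_ge0 T; set t := T ^+ 2 => t0.
have := mulr_ge0 c1 s0; have := mulr_ge0 c2 s0.
have := mulr_ge0 t0 (mulr_ge0 c1 s0).
move: E1; set x := Cres B * mesh4; set y := Cres (_ * B) * mesh4 => E1.
have -> : 3 / 2 * (1 + t) * (Cres B + Cres (2 * K * B)) * mesh4 =
  3 / 2 * (x + y + t * x + t * y) by rewrite /x /y; ring.
lra.
Qed.
End ErrorEstimate.

Section Norms.
Context {R : realType}.
Variables (M : vec3 nat) (dt eps mu : R).
Hypotheses (eps_gt0 : 0 < eps) (mu_gt0 : 0 < mu).
Implicit Types (VE VH : vec3 (gridfun R)).

Lemma sum3_kinds k kx ky kz (F : vec3 nat -> R) :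
  k X = kx -> k Y = ky -> k Z = kz -> sum3 M k F =
  \sum_(a <- index_range kx (cx M)) \sum_(b <- index_range ky (cy M)) \sum_(c <-
    index_range kz (cz M)) F (a, b, c).
Proof. by move=> <- <- <-. Qed.

Lemma normE2E (P : R) (V : vec3 (gridfun R)) m : normE2 M P V m = dv M * P *
  comp_sum M false (fun d p => pr d V m (cx p) (cy p) (cz p) ^+ 2).
Proof.
rewrite /normE2 /comp_sum (@sum3_kinds _ Half Int Int)// (@sum3_kinds _ Int Half Int)//.
rewrite (@sum3_kinds _ Int Int Half)// /index_range !big_map.
congr (_ * (_ + _ + _)); apply: eq_bigr => i _; rewrite !big_map;
  by apply: eq_bigr => j _; rewrite !big_map.
Qed.

Lemma normH2E (P : R) (V : vec3 (gridfun R)) m : normH2 M P V m = dv M * P *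
  comp_sum M true (fun d p => pr d V m (cx p) (cy p) (cz p) ^+ 2).
Proof.
rewrite /normH2 /comp_sum (@sum3_kinds _ IntB Half Half)// (@sum3_kinds _ Half IntB Half)//.
rewrite (@sum3_kinds _ Half Half IntB)// /index_range !big_map.
congr (_ * (_ + _ + _)); apply: eq_bigr => i _; rewrite !big_map;
  by apply: eq_bigr => j _; rewrite !big_map.
Qed.

Lemma norms_energy VE VH m :
  normE2 M eps VE m + normH2 M mu VH m + dt ^+ 2 / (4 * mu * eps) *
    (normH2 M eps (delta1h M VE) m + normE2 M mu (delta2h M VH) m)
  = energy (kappa eps mu) M dt (grid_state VE VH m).
Proof.
rewrite /energy /norm2 /inner_prod !normE2E !normH2E /=.
set s := grid_state VE VH m; set SE := comp_sum M false _; set SH := comp_sum M true _.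
set DH := comp_sum M true (fun d p => _ ^+ 2); set DE := comp_sum M false (fun d p => _ ^+ 2).
have curlE f (F : dir -> vec3 nat -> R) :
    (forall d p, curlB (kappa eps mu) M s f d p = - (kappa eps mu f * F d p)) ->
    comp_sum M f (fun d p => curlB (kappa eps mu) M s f d p * curlB (kappa eps mu) M s f d p)
    = kappa eps mu f ^+ 2 * comp_sum M f (fun d p => F d p ^+ 2).
  move=> HF; rewrite -[RHS]addr0 -(mul0r (comp_sum M f (fun d p => F d p ^+ 2))) -comp_sum_lin.
  by congr comp_sum; apply/funext => d; apply/funext => p; rewrite HF; ring.
rewrite (curlE false (fun d p => pr d (delta2h M VH) m (cx p) (cy p) (cz p)));
  last by move=> [] p.
rewrite (curlE true (fun d p => pr d (delta1h M VE) m (cx p) (cy p) (cz p)));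
  last by move=> [] p.
rewrite -/DE -/DH /= !invrK; field.
by rewrite !gt_eqF.
Qed.
End Norms.

Theorem theorem4p5 (R : realType) (T eps mu : R)
    (e h : R -> vec3 R -> vec3 R) (E0 H0 : vec3 R -> vec3 R)
    (T_gt0 : 0 < T) (eps_gt0 : 0 < eps) (mu_gt0 : 0 < mu)
    (maxwell_eh : maxwell T eps mu e h)
    (pec_eh : pec T e h)
    (init_e : forall p, Omega p -> e 0 p = E0 p)
    (init_h : forall p, Omega p -> h 0 p = H0 p)
    (reg_e : CmCk T 0 4 e /\ CmCk T 1 2 e /\ CmCk T 2 1 e /\ CmCk T 3 0 e)
    (reg_h : CmCk T 0 4 h /\ CmCk T 1 2 h /\ CmCk T 2 1 h /\ CmCk T 3 0 h) :
  exists C : R,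
    forall I J K N : nat,
      (2 <= I)%N -> (2 <= J)%N -> (2 <= K)%N -> (1 <= N)%N ->
    let M := (I, J, K) in
    let dx : R := cx (step M) in
    let dy : R := cy (step M) in
    let dz : R := cz (step M) in
    let dt : R := T / N%:R in
    forall E H : vec3 (gridfun R), adi_fdtd M N dt eps mu E0 H0 E H ->
    let errE := grid_error M dt e E in
    let errH := grid_error M dt h H in
    let dtE := map3 (delta_t dt) errE in
    let dtH := map3 (delta_t dt) errH in
    forall n : nat, n.+1%:R * dt <= T ->
      normE2 M eps errE (int_idx n.+1) + normH2 M mu errH (int_idx n.+1)
        + dt ^+ 2 / (4 * mu * eps) *
          (normH2 M eps (delta1h M errE) (int_idx n.+1)
           + normE2 M mu (delta2h M errH) (int_idx n.+1))
        <= C * (dt ^+ 4 + dx ^+ 4 + dy ^+ 4 + dz ^+ 4)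
      /\
      normE2 M eps dtE (half_idx n) + normH2 M mu dtH (half_idx n)
        + dt ^+ 2 / (4 * mu * eps) *
          (normH2 M eps (delta1h M dtE) (half_idx n)
           + normE2 M mu (delta2h M dtH) (half_idx n))
        <= C * (dt ^+ 4 + dx ^+ 4 + dy ^+ 4 + dz ^+ 4).
Proof.
have kap_gt0 f : 0 < kappa eps mu f by case: f; rewrite invr_gt0.
have regE := conj reg_e.1 reg_e.2.1.
have regH := conj reg_h.1 reg_h.2.1.
have [B HU] := solution_field T_gt0 eps_gt0 mu_gt0 maxwell_eh pec_eh regE regH.
exists (Cerr (kappa eps mu) T B) => I J K N I2 J2 K2 N1 M dx dy dz dt E H scheme
  errE errH dtE dtH n nT.
have M_gt1 q : (1 < pr q M)%N by case: q.
have N0 : 0 < N%:R :> R by rewrite ltr0n.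
have dt0 : 0 < dt by rewrite divr_gt0.
have nN : (n < N)%N.
  rewrite -(ler_nat R) -(ler_pM2r dt0); apply: le_trans nT _.
  by rewrite /dt mulrC divfK// gt_eqF.
pose w m := grid_state E H m.*2.
have w_pec m : (m <= N)%N -> pec_state M (w m).
  by move=> mN; apply: (num_pec scheme); rewrite leq_double.
have w_scheme m f d p : (m < N)%N -> on_grid M f d p -> inner M f d p ->
    residual (kappa eps mu) M dt (w m) (w m.+1) f d p = 0.
  by move=> mN g i; apply: (residual_num scheme dt0 eps_gt0 mu_gt0 mN g i).
have w_init f d p : on_grid M f d p -> w 0%N f d p = sample M (solution e h) 0 f d p.
  move=> g; have Op : Omega (grid_node (R := R) M p).
    by apply: (Omega_grid_node M_gt1) => q; have [] := g q.
  rewrite /sample /solution /partials /=.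
  have -> : (if f then h else e) 0 (grid_node M p) = (if f then H0 else E0) (grid_node M p).
    by case: (f); [exact: init_h|exact: init_e].
  case: p g {Op} => [[a b] c] g; have [[EX [EY [EZ [HX [HY HZ]]]]] _ _] := scheme.
  have := grid_cases g; move/(_ (fun a b c => w 0%N f d (a, b, c) =
     pr d ((if f then H0 else E0) (node M a b c)))); apply.
  by case: (f); case: (d).
have errE_eq m : grid_state errE errH m.*2 = err M dt (solution e h) w m.
  apply/funext => f; apply/funext => d; apply/funext => p.
  have tE : instant dt m.*2 = m%:R * dt.
    by rewrite /instant -muln2 natrM; field.
  rewrite /err /lincomb /sample /solution /partials /= -tE mul1r mulN1r.
  by rewrite /w /grid_state /errE /errH /grid_error; case: (f); case: (d).
split; rewrite !norms_energy//.
- rewrite errE_eq.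
  exact: (error_estimate kap_gt0 M_gt1 T_gt0 N1 erefl HU w_pec w_scheme w_init nN).
- have -> : grid_state dtE dtH (half_idx n) = err_dt M dt (solution e h) w n.
    apply/funext => f; apply/funext => d; apply/funext => p.
    rewrite /err_dt /lincomb -!errE_eq /dtE /dtH /grid_state /map3 /delta_t.
    by case: (f); case: (d) => /=; rewrite /pr /cx /cy /cz /half_idx /=; ring.
  exact: (error_estimate_dt kap_gt0 M_gt1 T_gt0 N1 erefl HU w_pec w_scheme w_init nN).
Qed.
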